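(* Let $\gamma\in(0,\infty)$, let $Q$ and $B$ be a $\Lambda$-periodic admissible quadratic form and prestrain, and assume $\frac1{C_\Lambda}I\le\Lambda^\top\Lambda\le C_\Lambda I$ for a constant $C_\Lambda>0$. Let $G_1,G_2,G_3$ be an orthonormal basis of $\mathbb R^{2\times2}_{\rm sym}$ and denote by $(M_{G_i},\varphi_{G_i})$ the corrector associated with $G_i$. (a) (Representation of $Q^\gamma_{\rm hom}$) The matrix $\widehat Q\in\mathbb R^{3\times3}$ defined by $$\widehat Q_{ik}:=\frac1{|\Box_\Lambda|}\int_{\Box_\Lambda}\mathbb L\big(\iota(x_3G_i+M_{G_i})+\mathrm{sym}(\nabla_\gamma\varphi_{G_i})\big):\iota(x_3G_k)\,d(x_3,y)$$ is symmetric and positive definite, and $\frac\alpha{12}I_{3\times3}\le\widehat Q\le\frac\beta{12}I_{3\times3}$ in the sense of quadratic forms. Moreover, for all $G\in\mathbb R^{2\times2}_{\rm sym}$, $$Q^\gamma_{\rm hom}(G)=\sum_{i,j=1}^3\widehat Q_{ij}\widehat G_i\widehat G_j,$$ where $\widehat G_1,\widehat G_2,\widehat G_3$ are the coefficients of $G$ with respect to $G_1,G_2,G_3$. (b) (Representation of $B^\gamma_{\rm eff}$) Define $\widehat B\in\mathbb R^3$ by $$\widehat B_i:=\frac1{|\Box_\Lambda|}\int_{\Box_\Lambda}\mathbb L\big(\iota(x_3G_i+M_{G_i})+\mathrm{sym}(\nabla_\gamma\varphi_{G_i})\big):B\,d(x_3,y),\qquad i=1,2,3.$$ Then $B^\gamma_{\rm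 eff}=\sum_{i=1}^3(\widehat Q^{-1}\widehat B)_iG_i$.
   Context: **Notation.** $|\cdot|$ and $:$ are the Frobenius norm and inner product, $\mathrm{sym}\,G=\frac12(G+G^\top)$; for $G\in\mathbb R^{2\times2}$, $\iota(G)\in\mathbb R^{3\times3}$ has upper-left block $G$ and vanishing third row and column. For $0<\alpha\le\beta<\infty$, $\mathcal Q(\alpha,\beta)$ is the set of quadratic forms on $\mathbb R^{3\times3}$ with $\alpha|\mathrm{sym}\,G|^2\le Q(G)\le\beta|\mathrm{sym}\,G|^2$; the associated tensor $\mathbb L$ is given by $\mathbb LF:G=\frac12(Q(F+G)-Q(F)-Q(G))$. For invertible $\Lambda\in\mathbb R^{2\times2}$, a function of $y\in\mathbb R^2$ is $\Lambda$-periodic if invariant under translations in $\Lambda\mathbb Z^2$; $Y_\Lambda=\Lambda[-\frac12,\frac12)^2$, $\Box_\Lambda=(-\frac12,\frac12)\times Y_\Lambda$ with points $(x_3,y)$. **Admissible pairs.** A Borel $Q:(-\frac12,\frac12)\times\mathbb R^2\times\mathbb R^{3\times3}\to\mathbb R$ is a $\Lambda$-periodic admissible quadratic form if $Q(x_3,y,\cdot)\in\mathcal Q(\alpha,\beta)$ for a.e. $(x_3,y)$ and $Q(x_3,\cdot,G)$ is $\Lambda$-periodic for all $G$ and a.e. $x_3$. A Borel $B:(-\frac12,\frac12)\times\mathbb R^2\to\mathbb R^{3\times3}_{\rm sym}$ is a $\Lambda$-periodic admissible prestrain if it is square integrable (on $\Box_\Lambda$) and $B(x_3,\cdot)$ is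 $\Lambda$-periodic for a.e. $x_3$. **Effective quantities.** $\nabla_\gamma=(\partial_{y_1},\partial_{y_2},\frac1\gamma\partial_3)$; $H^1_\gamma(\Box_\Lambda;\mathbb R^3)$ is the space of $\varphi\in H^1_{\rm loc}((-\frac12,\frac12)\times\mathbb R^2;\mathbb R^3)$, $\Lambda$-periodic in $y$, with $\int_{\Box_\Lambda}|\varphi|^2+|\nabla_\gamma\varphi|^2<\infty$. $Q^\gamma_{\rm hom}(G)=\inf_{M,\varphi}\frac1{|\Box_\Lambda|}\int_{\Box_\Lambda}Q(x_3,y,\iota(x_3G+M)+\mathrm{sym}\nabla_\gamma\varphi)\,d(x_3,y)$ for $G\in\mathbb R^{2\times2}_{\rm sym}$, the infimum over $M\in\mathbb R^{2\times2}_{\rm sym}$, $\varphi\in H^1_\gamma(\Box_\Lambda;\mathbb R^3)$. $\mathbf H_\Lambda$ is the Hilbert space of $\Lambda$-periodic (in $y$) fields $(-\frac12,\frac12)\times\mathbb R^2\to\mathbb R^{3\times3}_{\rm sym}$, square integrable on $\Box_\Lambda$, with inner product $\frac1{|\Box_\Lambda|}\int_{\Box_\Lambda}\mathbb LG:G'$; $\mathbf H^\gamma_{{\rm rel},\Lambda}=\{\iota(M)+\mathrm{sym}\nabla_\gamma\varphi:M\in\mathbb R^{2\times2}_{\rm sym},\varphi\in H^1_\gamma(\Box_\Lambda;\mathbb R^3)\}$; $\mathbf H^\gamma_\Lambda=\{\iota(x_3G)+\chi:G\in\mathbb R^{2\times2}_{\rm sym},\chi\in\mathbf H^\gamma_{{\rm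 rel},\Lambda}\}$; $P^{\gamma,\perp}_{{\rm rel},\Lambda}$ is the orthogonal projection of $\mathbf H_\Lambda$ onto $\mathbf H^{\gamma,\perp}_{{\rm rel},\Lambda}$, the orthogonal complement of $\mathbf H^\gamma_{{\rm rel},\Lambda}$ in $\mathbf H^\gamma_\Lambda$. $\mathbf E^\gamma_\Lambda:\mathbb R^{2\times2}_{\rm sym}\to\mathbf H^{\gamma,\perp}_{{\rm rel},\Lambda}$, $\mathbf E^\gamma_\Lambda(G)=P^{\gamma,\perp}_{{\rm rel},\Lambda}(\iota(x_3G))$, is a linear isomorphism, and $B^\gamma_{\rm eff}:=(\mathbf E^\gamma_\Lambda)^{-1}(P^{\gamma,\perp}_{{\rm rel},\Lambda}(\mathrm{sym}\,B))$. **Corrector.** For $G\in\mathbb R^{2\times2}_{\rm sym}$ the corrector $(M_G,\varphi_G)$ associated with $G$ is the unique pair $M_G\in\mathbb R^{2\times2}_{\rm sym}$, $\varphi_G\in H^1_\gamma(\Box_\Lambda;\mathbb R^3)$ with $\int_{\Box_\Lambda}\varphi_G=0$ such that $\int_{\Box_\Lambda}\mathbb L(\iota(x_3G+M_G)+\mathrm{sym}\nabla_\gamma\varphi_G):(\iota(M')+\mathrm{sym}\nabla_\gamma\varphi')\,d(x_3,y)=0$ for all $M'\in\mathbb R^{2\times2}_{\rm sym}$, $\varphi'\in H^1_\gamma(\Box_\Lambda;\mathbb R^3)$. *)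

(* Defs.v *)
From HB Require Import structures.
From mathcomp Require Import all_boot all_order all_algebra.
From mathcomp Require Import all_classical all_reals all_analysis.

Set Implicit Arguments.
Unset Strict Implicit.
Unset Printing Implicit Defensive.

Import Order.TTheory GRing.Theory Num.Theory.
Import numFieldNormedType.Exports.

Local Open Scope classical_set_scope.
Local Open Scope ring_scope.

(* Points are (x_3, (y_1, y_2)). *)
Notation pt3 R := (R * (R * R))%type.

(* The sigma-finite instance of the library on product measures is not inferred
   for Lebesgue measure: the one for subprobability measures shadows it. *)
Lemma product_sigma_finite d1 d2 (T1 : measurableType d1)
    (T2 : measurableType d2) (R : realType)
    (m1 : {sigma_finite_measure set T1 -> \bar R})
    (m2 : {sigma_finite_measure set T2 -> \bar R}) :
  sigma_finite setT (m1 \x m2)%E.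
Proof.
have /sigma_finiteP[F [TF ndF Foo]] := sigma_finiteT m1.
have /sigma_finiteP[G [TG ndG Goo]] := sigma_finiteT m2.
exists (fun n => F n `*` G n).
  rewrite -setXTT TF TG predeqE => -[x y]; split.
    move=> [/= [n _ Fnx] [k _ Gky]]; exists (maxn n k) => //; split.
    - by move: x Fnx; exact/subsetPset/ndF/leq_maxl.
    - by move: y Gky; exact/subsetPset/ndG/leq_maxr.
  by move=> [n _ []/= ? ?]; split; exists n.
move=> k; have [? ?] := Foo k; have [? ?] := Goo k.
split; first exact: measurableX.
by rewrite product_measure1E// lte_mul_pinfty// ge0_fin_numE.
Qed.

Definition leb2 (R : realType) :
    set (measurableTypeR R * measurableTypeR R)%type -> \bar R :=
  (@lebesgue_measure R \x @lebesgue_measure R)%E.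
HB.instance Definition _ (R : realType) := Measure.on (@leb2 R).
HB.instance Definition _ (R : realType) := Measure_isSigmaFinite.Build _ _ _
  (@leb2 R) (product_sigma_finite _ _).

Definition leb3 (R : realType) :
    set (measurableTypeR R * (measurableTypeR R * measurableTypeR R))%type ->
    \bar R :=
  (@lebesgue_measure R \x @leb2 R)%E.
HB.instance Definition _ (R : realType) := Measure.on (@leb3 R).
HB.instance Definition _ (R : realType) := Measure_isSigmaFinite.Build _ _ _
  (@leb3 R) (product_sigma_finite _ _).

Section Matrices.
Context {R : realType}.

Definition frob m n (F G : 'M[R]_(m, n)) : R := \sum_i \sum_j F i j * G i j.

Definition is_symmx n (F : 'M[R]_n) : Prop := F^T = F.

Definition sympart n (F : 'M[R]_n) : 'M[R]_n := 2^-1 *: (F + F^T).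

Definition embed3 (G : 'M[R]_2) : 'M[R]_3 := (block_mx G 0 0 0 : 'M[R]_(2 + 1)).

Definition quadratic_form (q : 'M[R]_3 -> R) : Prop :=
  exists b : {biscalar 'M[R]_3}, forall G, q G = b G G.

Definition quad_class (alpha beta : R) (q : 'M[R]_3 -> R) : Prop :=
  quadratic_form q /\
  forall G, alpha * frob (sympart G) (sympart G) <= q G
              <= beta * frob (sympart G) (sympart G).

Definition orthonormal_sym_basis (Gs : 'I_3 -> 'M[R]_2) : Prop :=
  [/\ forall i, is_symmx (Gs i),
      forall i j, frob (Gs i) (Gs j) = (i == j)%:R
    & forall G, is_symmx G -> exists c : 'cV[R]_3, G = \sum_i c i 0 *: Gs i].

End Matrices.

Definition borel_set (T : topologicalType) : set (set T) := <<s open >>.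

Definition borel_map (T U : topologicalType) (D : set T) (f : T -> U) : Prop :=
  forall V, open V -> borel_set (D `&` f @^-1` V).

Section Domain.
Context {R : realType}.
Implicit Types (Lam : 'M[R]_2).

(* The domain (-1/2, 1/2) x R^2; functions are total but only their values on
   layer matter. *)
Definition layer : set (pt3 R) := [set x | - 2^-1 < x.1 < 2^-1].

Definition lattice_map Lam (t : R * R) : R * R :=
  (Lam 0 0 * t.1 + Lam 0 1 * t.2, Lam 1 0 * t.1 + Lam 1 1 * t.2).

Definition translate Lam (k : int * int) (x : pt3 R) : pt3 R :=
  (x.1, x.2 + lattice_map Lam (k.1%:~R, k.2%:~R)).

Definition cell Lam : set (R * R) :=
  lattice_map Lam @` [set t | - 2^-1 <= t.1 < 2^-1 /\ - 2^-1 <= t.2 < 2^-1].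

Definition box Lam : set (pt3 R) :=
  [set x | - 2^-1 < x.1 < 2^-1 /\ cell Lam x.2].

(* Periodicity of an a.e.-class of functions. *)
Definition ae_periodic (T : Type) Lam (f : pt3 R -> T) : Prop :=
  forall k, {ae @leb3 R, forall x, layer x -> f (translate Lam k x) = f x}.

Definition avg Lam (f : pt3 R -> R) : R :=
  (fine (@leb3 R (box Lam)))^-1 * \int[@leb3 R]_(x in box Lam) f x.

End Domain.

Section Admissible.
Context {R : realType}.
Implicit Types (Lam : 'M[R]_2) (Q : pt3 R -> 'M[R]_3 -> R)
  (B F : pt3 R -> 'M[R]_3).

Definition admissible_form (alpha beta : R) Lam Q : Prop :=
  [/\ borel_map (layer `*` [set: 'M[R]_3])
        (fun p : pt3 R * 'M[R]_3 => Q p.1 p.2),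
      {ae @leb3 R, forall x, layer x -> quad_class alpha beta (Q x)}
    & forall G, {ae @lebesgue_measure R, forall x3, - 2^-1 < x3 < 2^-1 ->
        forall k y, Q (translate Lam k (x3, y)) G = Q (x3, y) G}].

Definition square_integrable Lam F : Prop :=
  (\int[@leb3 R]_(x in box Lam) (frob (F x) (F x))%:E < +oo)%E.

Definition admissible_prestrain Lam B : Prop :=
  [/\ borel_map layer B,
      forall x, layer x -> is_symmx (B x),
      square_integrable Lam B
    & {ae @lebesgue_measure R, forall x3, - 2^-1 < x3 < 2^-1 ->
        forall k y, B (translate Lam k (x3, y)) = B (x3, y)}].

(* The pairing LF : G at the point x, where L is the tensor of Q x. *)
Definition Lform Q (x : pt3 R) (F G : 'M[R]_3) : R :=
  2^-1 * (Q x (F + G) - Q x F - Q x G).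

End Admissible.

Section Sobolev.
Context {R : realType}.
Implicit Types (f eta : pt3 R -> R) (phi : pt3 R -> 'cV[R]_3)
  (D : pt3 R -> 'M[R]_3).

(* Gradients list the derivatives in the order (y_1, y_2, x_3), so that the
   first two columns of nabla match the upper-left block used by embed3. *)
Definition dir (j : 'I_3) : pt3 R :=
  ((j == 2%N :> nat)%:R, ((j == 0%N :> nat)%:R, (j == 1%N :> nat)%:R)).

Fixpoint Ck (n : nat) f : Prop :=
  match n with
  | 0 => continuous f
  | n'.+1 => continuous f /\ forall j,
      (forall x, derivable f x (dir j)) /\ Ck n' (fun x => 'D_(dir j) f x)
  end.

Definition test_function eta : Prop :=
  (forall n, Ck n eta) /\
  exists K, [/\ compact K, K `<=` layer & forall x, ~ K x -> eta x = 0].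

Definition L2loc f : Prop :=
  measurable_fun layer f /\
  forall K, compact K -> K `<=` layer ->
    (\int[@leb3 R]_(x in K) (f x ^+ 2)%:E < +oo)%E.

Definition weak_gradient phi D : Prop :=
  forall i j eta, test_function eta ->
    \int[@leb3 R]_(x in layer) (phi x i 0 * 'D_(dir j) eta x) =
    - \int[@leb3 R]_(x in layer) (D x i j * eta x).

(* phi is in H^1_loc and D is (a representative of) its weak gradient. *)
Definition H1loc phi D : Prop :=
  [/\ forall i, L2loc (fun x => phi x i 0),
      forall i j, L2loc (fun x => D x i j)
    & weak_gradient phi D].

Definition nabla (gamma : R) D (x : pt3 R) : 'M[R]_3 :=
  \matrix_(i, j) ((if j == 2%N :> nat then gamma^-1 else 1) * D x i j).

Definition H1gamma (gamma : R) (Lam : 'M[R]_2) phi D : Prop :=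
  [/\ H1loc phi D, ae_periodic Lam phi
    & (\int[@leb3 R]_(x in box Lam)
         (frob (phi x) (phi x) + frob (nabla gamma D x) (nabla gamma D x))%:E
       < +oo)%E].

End Sobolev.

Section Effective.
Context {R : realType}.
Variables (gamma : R) (Lam : 'M[R]_2) (Q : pt3 R -> 'M[R]_3 -> R).
Implicit Types (G M : 'M[R]_2) (phi : pt3 R -> 'cV[R]_3)
  (D F U V chi : pt3 R -> 'M[R]_3).

Definition bending G (x : pt3 R) : 'M[R]_3 := embed3 (x.1 *: G).

(* iota(M) + sym(nabla_gamma phi), where D is the weak gradient of phi. *)
Definition rel_strain M D (x : pt3 R) : 'M[R]_3 :=
  embed3 M + sympart (nabla gamma D x).

Definition Qhom G : R :=
  inf [set r | exists M phi D, [/\ is_symmx M, H1gamma gamma Lam phi D &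
    r = avg Lam (fun x => Q x (bending G x + rel_strain M D x))]].

Definition ipL F U : R := avg Lam (fun x => Lform Q x (F x) (U x)).

Definition HL F : Prop :=
  [/\ forall i j, measurable_fun layer (fun x => F x i j),
      {ae @leb3 R, forall x, layer x -> is_symmx (F x)},
      ae_periodic Lam F
    & square_integrable Lam F].

Definition Hrel F : Prop :=
  exists M phi D, [/\ is_symmx M, H1gamma gamma Lam phi D &
    forall x, layer x -> F x = rel_strain M D x].

Definition Hgamma F : Prop :=
  exists G chi, [/\ is_symmx G, Hrel chi &
    forall x, layer x -> F x = bending G x + chi x].

Definition Hrel_perp F : Prop :=
  Hgamma F /\ forall chi, Hrel chi -> ipL F chi = 0.

(* V represents the orthogonal projection of U in HL onto Hrel_perp. *)
Definition is_proj U V : Prop :=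
  [/\ HL U, Hrel_perp V
    & forall F, Hrel_perp F -> ipL (fun x => U x - V x) F = 0].

(* E(G) = P(sym B), i.e. G is the value of E^-1 at P(sym B). Projections are
   determined up to null sets, so a common representative V is asked for. *)
Definition is_Beff (B : pt3 R -> 'M[R]_3) G : Prop :=
  is_symmx G /\
  exists V, is_proj (bending G) V /\ is_proj (fun x => sympart (B x)) V.

Definition is_corrector G M phi D : Prop :=
  [/\ is_symmx M, H1gamma gamma Lam phi D,
      forall i, \int[@leb3 R]_(x in box Lam) phi x i 0 = 0
    & forall M' phi' D', is_symmx M' -> H1gamma gamma Lam phi' D' ->
        \int[@leb3 R]_(x in box Lam)
          Lform Q x (bending G x + rel_strain M D x) (rel_strain M' D' x) = 0].

Definition Qhat (Gs Ms : 'I_3 -> 'M[R]_2) (Ds : 'I_3 -> pt3 R -> 'M[R]_3) :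
    'M[R]_3 :=
  \matrix_(i, k) avg Lam (fun x =>
    Lform Q x (bending (Gs i) x + rel_strain (Ms i) (Ds i) x)
      (bending (Gs k) x)).

Definition Bhat (B : pt3 R -> 'M[R]_3) (Gs Ms : 'I_3 -> 'M[R]_2)
    (Ds : 'I_3 -> pt3 R -> 'M[R]_3) : 'cV[R]_3 :=
  \col_i avg Lam (fun x =>
    Lform Q x (bending (Gs i) x + rel_strain (Ms i) (Ds i) x) (B x)).

End Effective.

Definition quad_val (R : realType) n (A : 'M[R]_n) (v : 'cV[R]_n) : R :=
  (v^T *m A *m v) 0 0.

(* Main.v *)
(* Put E_i = iota(x_3 G_i + M_i) + sym nabla_gamma phi_i. The corrector equation
   says that E_i is the part of iota(x_3 G_i) orthogonal to the relaxation strains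
   in the energy inner product, hence Qhat is the Gram matrix of the E_i. The
   formula for Qhom is the minimality of an orthogonal projection, and the formula
   for Beff is the normal equation Qhat c = Bhat of the projection of B on the span
   of the E_i.
   The upper bound on Qhat compares with the competitor M = 0, phi = 0. The lower
   bound needs that x_3 G is L^2-orthogonal to M + sym nabla' phi, that is,
   that the weak derivatives of phi along y have zero integral over the box when
   weighted by x_3. This follows by testing with psi(x_3) h(t_1) h(t_2), where
   t = Lam^-1 y and h is a smooth approximation of the indicator of [-1/2, 1/2)
   with h'(t) = b(t + 1/2) - b(t - 1/2): by periodicity the two terms cancel. *)
Require Import Defs.
From mathcomp Require Import all_boot all_order all_algebra.
From mathcomp Require Import all_classical all_reals all_analysis.
From mathcomp Require Import ring lra measurable_realfun.
Import Order.TTheory GRing.Theory Num.Theory.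
Import numFieldNormedType.Exports.
Local Open Scope classical_set_scope.
Local Open Scope ring_scope.

Set Implicit Arguments.
Unset Strict Implicit.
Unset Printing Implicit Defensive.

(** * Borel maps and product-measurability *)

(** Fields are functions, not classes, and each relaxation strain comes with a chosen representative
    [D] of a weak gradient. The energy product is therefore bilinear only on square-integrable
    fields and only semidefinite there, as fields may differ on null sets. The projection argument
    is carried out for such a form on an arbitrary module: a null vector is orthogonal to everything
    by Cauchy-Schwarz, and this stands in for uniqueness of projections. Their existence is read off
    from the given correctors, so that (b) becomes a 3x3 linear system, solvable because of the
    lower bound in (a). In that bound the weight [x_3] is not compactly supported in the layer and
    the indicator of a cell is not smooth, so two limits are taken. The smoothing in y is removed
    first, on a fixed compact set, where local square-integrability of [D] dominates; then the
    cut-off in [x_3], where integrability of [D] on the box dominates. *)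

Section Borel.
Context {R : realType} d (T : measurableType d).

Lemma measurable_fun_open (D : set T) (f : T -> R) :
  (forall V, open V -> measurable (D `&` f @^-1` V)) -> measurable_fun D f.
Proof.
move=> H mD; apply: (measurability _ (RGenOpens.measurableE R)) => //.
move=> _ [_ [a [b ->] <-]]; apply: H.
exact: interval_open.
Qed.

(** The coordinates [c k] control the balls, so every open set is a union of sets [bx r] with
    rational centre and radius 1/(n+1). There are countably many such [r], and each piece is a
    finite intersection of measurable conditions on the real functions [c k (g x)]. *)
Lemma open_preimage_measurable (U : pseudoMetricType R) (K : finType)
    (c : K -> U -> R) (D : set T) (g : T -> U) (V : set U) :
  (forall p q e, 0 < e -> (forall k, `|c k p - c k q| < e) -> ball p e q) ->
  measurable D -> (forall k, measurable_fun D (fun x => c k (g x))) ->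
  open V -> measurable (D `&` g @^-1` V).
Proof.
move=> cb mD mg oV.
pose bx (r : {ffun K -> rat} * nat) : set U :=
  [set q | forall k, `|c k q - ratr (r.1 k)| < r.2.+1%:R^-1].
have -> : D `&` g @^-1` V =
    \bigcup_(r in [set r | bx r `<=` V]) (D `&`
      \bigcap_(k in [set: K])
        (D `&` [set x | `|c k (g x) - ratr (r.1 k)| < r.2.+1%:R^-1])).
  apply/seteqP; split => [x [Dx Vx]|x [r /= rV [Dx h]]]; last first.
    by split => //; apply: rV => k; have [] := h k Logic.I.
  have /nbhs_ballP[e /= e0 eV] : nbhs (g x) V by move: oV; rewrite openE; exact.
  (* Both [g x] and a point of [bx] lie within 1/(n+1) of the rational centre, hence the factor
     2. *)
  have [n n2] : exists n, 2 * n.+1%:R^-1 < e.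
    have e20 : 0 < e / 2 by rewrite divr_gt0.
    have [n _ /(_ n (leqnn n))/= hn] := near_infty_natSinv_lt (PosNum e20).
    by exists n; rewrite -ltr_pdivlMl// mulrC.
  have n0 : 0 < n.+1%:R^-1 :> R by rewrite invr_gt0 ltr0n.
  have /choice[r hr] k : exists q : rat, `|c k (g x) - ratr q| < n.+1%:R^-1.
    have /rat_in_itvoo[q] : c k (g x) - n.+1%:R^-1 < c k (g x) + n.+1%:R^-1.
      by rewrite ltrBlDr -addrA ltrDl addr_gt0.
    rewrite in_itv/= => /andP[q1 q2]; exists q.
    by rewrite ltr_distlC q1 q2.
  exists ([ffun k => r k], n) => /=.
    move=> q hq; apply: eV; apply: cb => // k.
    have := hq k; have := hr k; rewrite /= ffunE => h1 h2.
    rewrite -(subrKA (ratr (r k))); apply: le_lt_trans (ler_normD _ _) _.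
    apply: lt_trans n2; rewrite mulr2n mulrDl mul1r ltrD// distrC //.
  split => // k _; split => //=; rewrite /= ffunE; exact: hr.
rewrite bigcup_mkcond; apply: countable_bigcupT_measurable => // r.
case: ifPn => // _; apply: measurableI => //.
apply: fin_bigcap_measurable => // k _.
have mr : measurable_fun D (fun x => c k (g x) - ratr (r.1 k)).
  by apply: measurable_funB => //; exact: measurable_cst.
rewrite (_ : [set x | _] = (fun x => c k (g x) - ratr (r.1 k)) @^-1`
    `]- r.2.+1%:R^-1, r.2.+1%:R^-1[); first by apply: mr => //; exact: measurable_itv.
by apply/funext => x /=; rewrite in_itv/= ltr_norml.
Qed.

(** The sets whose preimage under [g] meets [D] in a measurable set form a sigma-algebra. It
    contains the open sets, hence all Borel sets, in particular those that [h] pulls back from open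
    sets. *)
Lemma measurable_borel_comp (U V : topologicalType) (D : set T) (g : T -> U)
    (S : set U) (h : U -> V) :
  (forall W, open W -> measurable (D `&` g @^-1` W)) -> measurable D ->
  (forall x, D x -> S (g x)) -> borel_map S h ->
  forall W, open W -> measurable (D `&` (h \o g) @^-1` W).
Proof.
move=> mg mD DS bh W oW.
have -> : D `&` (h \o g) @^-1` W = D `&` g @^-1` (S `&` h @^-1` W).
  by apply/seteqP; split => [x [Dx Wx]|x [Dx [_ Wx]]]; split => //; split => //;
    exact: DS.
have := bh W oW; rewrite /borel_set.
suff : <<s open >> `<=` [set A | measurable (D `&` g @^-1` A)] by exact.
apply: smallest_sub => //; split => /=.
- by rewrite preimage_set0 setI0.
- move=> A mA; rewrite setTD preimage_setC.
  rewrite (_ : _ `&` _ = D `\` (D `&` g @^-1` A)); first exact: measurableD.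
  by rewrite setDE setCI setIUr setICr set0U.
- move=> F mF; rewrite preimage_bigcup setI_bigcupr.
  exact: bigcupT_measurable.
Qed.

End Borel.

Notation mpt R :=
  (measurableTypeR R * (measurableTypeR R * measurableTypeR R))%type.

Section LayerMeasurability.
Context {R : realType}.
Implicit Types (F B : pt3 R -> 'M[R]_3).

Lemma measurable_x3 (D : set (mpt R)) : measurable_fun D (fun x => x.1 : R).
Proof. by apply: measurable_funTS; exact: measurable_fst. Qed.

Lemma measurable_y1 (D : set (mpt R)) : measurable_fun D (fun x => x.2.1 : R).
Proof.
apply: measurable_funTS.
exact: (measurableT_comp (@measurable_fst _ _ _ _) (@measurable_snd _ _ _ _)).
Qed.

Lemma measurable_y2 (D : set (mpt R)) : measurable_fun D (fun x => x.2.2 : R).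
Proof.
apply: measurable_funTS.
exact: (measurableT_comp (@measurable_snd _ _ _ _) (@measurable_snd _ _ _ _)).
Qed.

Lemma measurable_layer : measurable (@layer R : set (mpt R)).
Proof.
rewrite (_ : layer = (fun x : mpt R => x.1 : R) @^-1` `]- 2^-1, 2^-1[).
  rewrite -[X in measurable X]setTI.
  by apply: measurable_x3 => //; exact: measurable_itv.
by apply/funext => x /=; rewrite in_itv.
Qed.

(** The twelve real coordinates of a point-matrix pair, indexed by a finite type; closeness in all
    of them is closeness in the product. *)
Definition pt_coord (k : option (bool + 'I_3 * 'I_3))
    (p : pt3 R * 'M[R]_3) : R :=
  match k with
  | None => p.1.1
  | Some (inl b) => if b then p.1.2.1 else p.1.2.2
  | Some (inr ij) => p.2 ij.1 ij.2
  end.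

Lemma pt_coord_ball (p q : pt3 R * 'M[R]_3) e : 0 < e ->
  (forall k, `|pt_coord k p - pt_coord k q| < e) -> ball p e q.
Proof.
move=> e0 H; have b1 : ball p.1 e q.1.
  split; first exact: (H None).
  by split; [exact: (H (Some (inl true)))|exact: (H (Some (inl false)))].
have b2 : ball p.2 e q.2 by split => // i j; exact: (H (Some (inr (i, j)))).
by split.
Qed.

(** Bridge between two sigma-algebras: admissibility speaks of Borel sets of a topological product,
    integration of the product sigma-algebra. Used with [F] constant, it also shows that open sets
    of points are measurable for the latter. *)
Lemma measurable_point_matrix F (D : set (mpt R)) V : measurable D ->
  (forall i j, measurable_fun D (fun x => F x i j)) -> open V ->
  measurable (D `&` (fun x => (x, F x)) @^-1` V).
Proof.
move=> mD mF oV.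
apply: (open_preimage_measurable (c := pt_coord)) => //.
  exact: pt_coord_ball.
case=> [[[]|[i j]]|] /=.
- exact: measurable_y1.
- exact: measurable_y2.
- exact: mF.
- exact: measurable_x3.
Qed.

Lemma measurable_form (Q : pt3 R -> 'M[R]_3 -> R) F (D : set (mpt R)) :
  borel_map (layer `*` [set: 'M[R]_3]) (fun p => Q p.1 p.2) ->
  measurable D -> D `<=` layer ->
  (forall i j, measurable_fun D (fun x => F x i j)) ->
  measurable_fun D (fun x => Q x (F x)).
Proof.
move=> bQ mD Dl mF; apply: measurable_fun_open => W oW.
apply: (@measurable_borel_comp _ (mpt R) _ _ D (fun x => (x, F x)) _ _ _ _ _ bQ) => //.
  by move=> V oV; exact: (measurable_point_matrix mD mF oV).
by move=> x Dx; split => //; exact: Dl.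
Qed.

Lemma measurable_prestrain B : borel_map layer B ->
  forall i j, measurable_fun (layer : set (mpt R)) (fun x => B x i j).
Proof.
move=> bB i j; apply: measurable_fun_open => W oW.
have mid V : open V -> measurable ((layer : set (mpt R)) `&` id @^-1` V).
  move=> oV.
  have := @measurable_point_matrix (fun=> 0) layer (fst @^-1` V) measurable_layer.
  apply; last by apply: open_comp oV => x _; exact: cvg_fst.
  by move=> ? ?; exact: measurable_cst.
have := @measurable_borel_comp _ (mpt R) _ _ layer id layer B mid measurable_layer.
move=> /(_ (fun _ h => h) bB ((fun A => A i j) @^-1` W)); apply.
by apply: open_comp oW => A _; exact: coord_continuous.
Qed.

End LayerMeasurability.

(** * Smooth cut-off functions *)

Section OneVariable.
Context {R : realType}.
Implicit Types (f g : R -> R) (n k : nat).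

(** Derivatives enter as witnesses [f'], so that closure under sums, products, inverses and affine
    substitutions follows by induction on [n]. *)
Fixpoint diffn n f : Prop :=
  if n is n'.+1 then
    exists f', (forall x, is_derive x (1 : R) f (f' x)) /\ diffn n' f'
  else True.

Definition smooth f := forall n, diffn n f.

Lemma diffn_ext n f g : f =1 g -> diffn n f -> diffn n g.
Proof. by move=> /funext ->. Qed.

Lemma diffnW n f : diffn n.+1 f -> diffn n f.
Proof.
elim: n f => // n IH f [f' [df f'n]].
by exists f'; split => //; exact: IH.
Qed.

Lemma diffn_cst n c : diffn n (fun=> c).
Proof.
elim: n c => //= n IH c; exists (fun=> 0); split => // x.
exact: is_derive_cst.
Qed.

Lemma diffnD n f g : diffn n f -> diffn n g -> diffn n (fun x => f x + g x).
Proof.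
elim: n f g => //= n IH f g [f' [df f'n]] [g' [dg g'n]].
exists (fun x => f' x + g' x); split; last exact: IH.
by move=> x; apply: is_deriveD.
Qed.

Lemma diffnM n f g : diffn n f -> diffn n g -> diffn n (fun x => f x * g x).
Proof.
elim: n f g => // n IH f g fn gn.
have [[f' [df f'n]] [g' [dg g'n]]] := (fn, gn).
exists (fun x => f x * g' x + g x * f' x); split.
  by move=> x; apply: is_deriveM.
by apply: diffnD; apply: IH => //; exact: diffnW.
Qed.

Lemma diffnV n f : (forall x, f x != 0) -> diffn n f ->
  diffn n (fun x => (f x)^-1).
Proof.
move=> f0; elim: n => // n IH fn; have [f' [df f'n]] := fn.
exists (fun x => (-1 * ((f x)^-1 * (f x)^-1)) * f' x); split.
  move=> x; apply: (is_derive_eq (is_deriveV (f0 x) (df x))).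
  by rewrite mulN1r -expr2 exprVn scaleNr mulNr.
have Vn := IH (diffnW fn).
apply: diffnM => //; apply: diffnM; first exact: diffn_cst.
exact: diffnM.
Qed.

Lemma diffn_affine n f (a b : R) : diffn n f -> diffn n (fun x => f (a * x + b)).
Proof.
elim: n f => //= n IH f [f' [df f'n]].
exists (fun x => f' (a * x + b) * a); split; last first.
  by apply: diffnM; [exact: IH|exact: diffn_cst].
move=> x; apply: (@is_derive1_comp _ f (fun x => a * x + b)) => //.
apply: is_derive_eq.
by rewrite addr0 scaler1.
Qed.

Lemma diffn_continuous f : diffn 1 f -> continuous f.
Proof.
move=> [f' [df _]] x; apply: differentiable_continuous.
by apply/derivable1_diffP; case: (df x).
Qed.

(* The family [flat k] is closed under differentiation, whence its smoothness. *)
Definition flat k (t : R) : R := if 0 < t then t^-1 ^+ k * expR (- t^-1) else 0.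

(** One term of the exponential series at [t^-1] is at most [expR t^-1]. Taking the term of degree
    k+1 leaves a spare factor [t], which gives continuity at 0. *)
Lemma flat_le k t : `|flat k t| <= k.+1`!%:R * `|t|.
Proof.
rewrite /flat; case: ifPn => [t0|_]; last by rewrite normr0 mulr_ge0.
have ti : 0 <= t^-1 by rewrite invr_ge0 ltW.
rewrite ger0_norm ?mulr_ge0 ?exprn_ge0 ?expR_ge0// (gtr0_norm t0).
have fk : 0 < k.+1`!%:R :> R by rewrite ltr0n fact_gt0.
have : t^-1 ^+ k.+1 / k.+1`!%:R <= expR t^-1.
  by apply: le_trans (expR_ge1Dxn k ti); rewrite lerDr.
rewrite ler_pdivrMr// exprS => H.
rewrite expRN ler_pdivrMr ?expR_gt0//.
rewrite -mulrA [t * _]mulrC mulrA -ler_pdivrMr//.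
by rewrite mulrC [_ * expR _]mulrC.
Qed.


Lemma flat_derive k x : is_derive x (1 : R) (flat k)
  (- k%:R * flat k.+1 x + flat k.+2 x).
Proof.
have [x0|x0|->] := ltgtP x 0.
- apply: (@near_eq_is_derive _ _ _ (fun=> 0)).
    near=> y; rewrite /flat; case: ifPn => // y0.
    have : y < 0 by near: y; exact: lt_nbhsl.
    by rewrite ltNge (ltW y0).
  apply: (is_derive_eq (is_derive_cst _ _ _)).
  by rewrite /flat [0 < x]ltNge (ltW x0)/= mulr0 addr0.
- have xn0 : x != 0 by rewrite gt_eqF.
  apply: (@near_eq_is_derive _ _ _ (fun t : R => t^-1 ^+ k * expR (- t^-1))).
    near=> y; rewrite /flat; case: ifPn => // /negP; elim.
    by near: y; exact: lt_nbhsr.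
  have dV : is_derive x (1 : R) (fun t : R => t^-1) (- x^-1 ^+ 2).
    apply: (is_derive_eq (is_deriveV xn0 (is_derive_id _ _))).
    by rewrite scaler1 exprVn.
  have dN : is_derive x (1 : R) (fun t : R => - t^-1) (x^-1 ^+ 2).
    by apply: (is_derive_eq (is_deriveN dV)); rewrite opprK.
  have dE := @is_derive1_comp _ expR (fun t => - t^-1) x _ _ (is_derive_expR _) dN.
  have dX := is_deriveX k dV.
  rewrite (_ : (fun t : R => _) =
      ((fun t : R => t^-1) ^+ k) * (expR \o (fun t : R => - t^-1))); last first.
    by apply/funext => t; rewrite !fctE.
  apply: (is_derive_eq (is_deriveM dX dE)).
  rewrite /flat x0 (_ : _ x = x^-1 ^+ k :> R); last by rewrite !fctE.
  rewrite /GRing.scale/=; case: k dX => [|k] _ /=.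
    by rewrite !expr0 !exprS; ring.
  by rewrite !exprS; ring.
(* At 0 the slope function of [flat k] is [flat k.+1], because [flat k z = z * flat k.+1 z]; its
   continuity at 0 is [flat_le]. *)
- apply/is_derive1_caratheodory; exists (flat k.+1); split.
  + move=> z; rewrite {1 2}/flat ltxx !subr0 /flat; case: ifPn => z0;
      last by rewrite mul0r.
    by rewrite exprS; field; rewrite gt_eqF.
  + apply/cvgrPdist_lt => e e0; near=> t.
    rewrite {1}/flat ltxx sub0r normrN; apply: le_lt_trans (flat_le _ _) _.
    have c0 : 0 < k.+2`!%:R :> R by rewrite ltr0n fact_gt0.
    rewrite mulrC -ltr_pdivlMr// -(subr0 t) distrC.
    near: t; apply: (@cvgr_dist_lt _ _ _ (nbhs (0:R)) _ id) => //.
    exact: divr_gt0.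
  + by rewrite /flat !ltxx !mulr0 addr0.
Unshelve. all: by end_near. Qed.

Lemma smooth_flat k : smooth (flat k).
Proof.
move=> n; elim: n k => //= n IH k.
exists (fun x => - k%:R * flat k.+1 x + flat k.+2 x); split.
  exact: flat_derive.
by apply: diffnD => //; apply: diffnM => //; exact: diffn_cst.
Qed.

Lemma flat_ge0 k t : 0 <= flat k t.
Proof.
rewrite /flat; case: ifP => // t0.
by rewrite mulr_ge0 ?expR_ge0// exprn_ge0// invr_ge0 ltW.
Qed.

Lemma flat_gt0 k t : 0 < t -> 0 < flat k t.
Proof. by move=> t0; rewrite /flat t0 mulr_gt0 ?expR_gt0// exprn_gt0// invr_gt0. Qed.

Lemma flat_le0 k t : t <= 0 -> flat k t = 0.
Proof. by rewrite /flat leNgt => /negbTE ->. Qed.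

(** The usual smooth transition from 0 to 1, with its ramp on [-1, 0]. *)
Definition step (t : R) : R :=
  flat 0 (t + 1) * (flat 0 (t + 1) + flat 0 (- t))^-1.

(** [t + 1] and [- t] have sum 1, so one of them is positive. *)
Lemma step_den_gt0 t : 0 < flat 0 (t + 1) + flat 0 (- t).
Proof.
have [t0|t0] := ltP t 0.
  by rewrite ltr_wpDl ?flat_ge0// flat_gt0// oppr_gt0.
by rewrite ltr_wpDr ?flat_ge0// flat_gt0// ltr_wpDl.
Qed.

Lemma smooth_step : smooth step.
Proof.
move=> n.
have a1 : diffn n (fun t => flat 0 (t + 1)).
  apply: (@diffn_ext n (fun t => flat 0 (1 * t + 1))).
    by move=> t; rewrite mul1r.
  exact/diffn_affine/smooth_flat.
have a2 : diffn n (fun t => flat 0 (- t)).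
  apply: (@diffn_ext n (fun t => flat 0 (-1 * t + 0))).
    by move=> t; rewrite mulN1r addr0.
  exact/diffn_affine/smooth_flat.
apply: diffnM => //; apply: diffnV; last exact: diffnD.
by move=> t; rewrite gt_eqF// step_den_gt0.
Qed.

Lemma step_eq0 t : t <= -1 -> step t = 0.
Proof. by move=> t1; rewrite /step flat_le0 ?mul0r// -lerBrDr sub0r. Qed.

Lemma step_eq1 t : 0 <= t -> step t = 1.
Proof.
move=> t0; have := step_den_gt0 t; rewrite /step (@flat_le0 _ (- t)) ?oppr_le0//.
by rewrite addr0 => d0; rewrite mulfV// gt_eqF.
Qed.

Lemma step_ge0 t : 0 <= step t.
Proof. by rewrite mulr_ge0 ?flat_ge0// invr_ge0 ltW// step_den_gt0. Qed.

Lemma step_le1 t : step t <= 1.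
Proof. by rewrite ler_pdivrMr ?step_den_gt0// mul1r lerDl flat_ge0. Qed.

End OneVariable.

(** * Directional derivatives of smooth functions of linear forms *)

Section TestFunctions.
Context {R : realType}.
Implicit Types (f g : pt3 R -> R) (l : pt3 R -> R) (x v : pt3 R).

Lemma is_derive_line f x v d :
  is_derive (0 : R) (1 : R) (fun h : R => f (h *: v + x)) d -> is_derive x v f d.
Proof.
have E : (fun h : R => h^-1 *: ((f \o shift x) (h *: v) - f x)) =
    (fun h : R => h^-1 *: (((fun h : R => f (h *: v + x)) \o shift 0) (h *: 1)
      - f (0 *: v + x))).
  by apply/funext => h /=; rewrite addr0 scale0r add0r /(_ *: 1) /= mulr1.
move=> [dL eL]; split; first by move: dL; rewrite /derivable -E.
by move: eL; rewrite /derive -E.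
Qed.

Definition linear_form l := forall (h : R) v x, l (h *: v + x) = h * l v + l x.

Lemma is_derive_linear_form (g : R -> R) l x v d : linear_form l ->
  is_derive (l x) (1 : R) g d -> is_derive x v (fun y => g (l y)) (l v * d).
Proof.
move=> ll dg; apply: is_derive_line.
rewrite (_ : (fun h => _) = g \o (fun h : R => h * l v + l x)); last first.
  by apply/funext => h /=; rewrite ll.
rewrite mulrC; apply: is_derive1_comp; first by rewrite mul0r add0r.
have := is_deriveD (is_deriveM (is_derive_id (0:R) 1) (is_derive_cst (l v) (0:R) 1))
  (is_derive_cst (l x) (0:R) 1).
by rewrite scaler0 add0r addr0 /GRing.scale/= mulr1.
Qed.

(* A reformulation of [Ck] by existence of partial derivatives, so that
   closure properties follow by induction. *)
Fixpoint pdiff n f : Prop :=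
  continuous f /\
  if n is n'.+1 then forall j, exists f',
    (forall x, is_derive x (dir j) f (f' x)) /\ pdiff n' f'
  else True.

Lemma pdiff_Ck n f : pdiff n f -> Ck n f.
Proof.
elim: n f => [f []//|n IH f [cf df]] /=; split => // j.
have [f' [df' f'n]] := df j; split; first by move=> x; case: (df' x).
rewrite (_ : (fun x => _) = f'); first exact: IH.
by apply/funext => x; case: (df' x).
Qed.

Lemma pdiffW n f : pdiff n.+1 f -> pdiff n f.
Proof.
elim: n f => [f []//|n IH f [cf df]]; split => // j.
by have [f' [df' f'n]] := df j; exists f'; split => //; exact: IH.
Qed.

Lemma pdiffD n f g : pdiff n f -> pdiff n g -> pdiff n (fun x => f x + g x).
Proof.
elim: n f g => [f g [cf _] [cg _]|n IH f g [cf df] [cg dg]].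
  by split => // x; exact: continuousD (cf x) (cg x).
split; first by move=> x; exact: continuousD (cf x) (cg x).
move=> j; have [[f' [df' f'n]] [g' [dg' g'n]]] := (df j, dg j).
exists (fun x => f' x + g' x); split; last exact: IH.
by move=> x; exact: is_deriveD.
Qed.

Lemma pdiffM n f g : pdiff n f -> pdiff n g -> pdiff n (fun x => f x * g x).
Proof.
elim: n f g => [f g [cf _] [cg _]|n IH f g fn gn].
  by split => // x; exact: continuousM (cf x) (cg x).
have [[cf df] [cg dg]] := (fn, gn).
split; first by move=> x; exact: continuousM (cf x) (cg x).
move=> j; have [[f' [df' f'n]] [g' [dg' g'n]]] := (df j, dg j).
exists (fun x => f x * g' x + g x * f' x); split.
  by move=> x; exact: is_deriveM.
by apply: pdiffD; apply: IH => //; exact: pdiffW.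
Qed.

Lemma pdiff_cst n (c : R) : pdiff n (fun=> c).
Proof.
elim: n c => [|n IH] c; split => //; try exact: cst_continuous.
by move=> j; exists (fun=> 0); split => // x; exact: is_derive_cst.
Qed.

Lemma pdiff_comp n (g : R -> R) l : continuous l -> linear_form l ->
  smooth g -> pdiff n (fun x => g (l x)).
Proof.
move=> cl ll.
have cgl h : diffn 1 h -> continuous (fun x => h (l x)).
  move=> /diffn_continuous ch x.
  by apply: (@continuous_comp _ _ _ l h); [exact: cl|exact: ch].
(* One order beyond [n] is kept: it makes the last derivative, which must be continuous,
   differentiable. *)
move=> sg; have {sg} := sg n.+1; elim: n g => [|n IH] g gn.
  by split => //; exact: cgl.
split; first by apply: cgl; case: gn => g' [dg _]; exists g'.
move=> j; have [g' [dg g'n]] := gn.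
exists (fun x => l (dir j) * g' (l x)); split.
  by move=> x; exact: is_derive_linear_form.
by apply: pdiffM; [exact: pdiff_cst|exact: IH].
Qed.

End TestFunctions.

(** * Lattice coordinates and product test functions *)

Section Lattice.
Context {R : realType}.
Implicit Types (Lam : 'M[R]_2) (x v : pt3 R).

Lemma lattice_mapM (A B : 'M[R]_2) t :
  lattice_map A (lattice_map B t) = lattice_map (A *m B) t.
Proof.
rewrite /lattice_map /= !mxE !big_ord_recl !big_ord0 /=.
have -> : lift ord0 ord0 = 1 :> 'I_2 by apply/val_inj.
have -> : ord0 = 0 :> 'I_2 by apply/val_inj.
by congr pair; ring.
Qed.

Lemma lattice_map1 t : lattice_map (1%:M : 'M[R]_2) t = t.
Proof.
by rewrite /lattice_map !mxE /= !mul1r !mul0r addr0 add0r -surjective_pairing.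
Qed.

Lemma lattice_mapK Lam : Lam \in unitmx ->
  cancel (lattice_map Lam) (lattice_map (invmx Lam)).
Proof. by move=> uL t; rewrite lattice_mapM mulVmx// lattice_map1. Qed.

Lemma lattice_mapVK Lam : Lam \in unitmx ->
  cancel (lattice_map (invmx Lam)) (lattice_map Lam).
Proof. by move=> uL t; rewrite lattice_mapM mulmxV// lattice_map1. Qed.

Lemma lattice_map_linear Lam (h : R) u w :
  lattice_map Lam (h *: u + w) = h *: lattice_map Lam u + lattice_map Lam w.
Proof.
by congr pair; rewrite /= /GRing.scale/=; ring.
Qed.

Lemma continuous_lattice_map Lam : continuous (lattice_map Lam).
Proof.
have H (a b : R) : continuous (fun t : R * R => a * t.1 + b * t.2).
  move=> t; apply: cvgD; apply: cvgM.
  - exact: cvg_cst.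
  - exact: cvg_fst.
  - exact: cvg_cst.
  - exact: cvg_snd.
move=> t.
exact: (cvg_pair (H (Lam 0 0) (Lam 0 1) t) (H (Lam 1 0) (Lam 1 1) t)).
Qed.

Lemma fst_linear : linear_form (fun x : pt3 R => x.1).
Proof. by []. Qed.

Lemma lat1_linear Lam : linear_form (fun x : pt3 R => (lattice_map Lam x.2).1).
Proof.
move=> h u w.
by rewrite -[(h *: u + w).2]/(h *: u.2 + w.2) lattice_map_linear.
Qed.

Lemma lat2_linear Lam : linear_form (fun x : pt3 R => (lattice_map Lam x.2).2).
Proof.
move=> h u w.
by rewrite -[(h *: u + w).2]/(h *: u.2 + w.2) lattice_map_linear.
Qed.

Lemma lat1_continuous Lam : continuous (fun x : pt3 R => (lattice_map Lam x.2).1).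
Proof.
move=> x; apply: (@continuous_comp _ _ _ (fun x => lattice_map Lam x.2) fst).
  apply: continuous_comp; [exact: cvg_snd|exact: continuous_lattice_map].
exact: cvg_fst.
Qed.

Lemma lat2_continuous Lam : continuous (fun x : pt3 R => (lattice_map Lam x.2).2).
Proof.
move=> x; apply: (@continuous_comp _ _ _ (fun x => lattice_map Lam x.2) snd).
  apply: continuous_comp; [exact: cvg_snd|exact: continuous_lattice_map].
exact: cvg_snd.
Qed.

(* [f1] and [f2] act on the lattice coordinates [Lam^-1 y]. *)
Definition eta3 Lam (f0 f1 f2 : R -> R) x : R :=
  f0 x.1 * (f1 (lattice_map (invmx Lam) x.2).1 *
            f2 (lattice_map (invmx Lam) x.2).2).

Lemma pdiff_eta3 n Lam f0 f1 f2 : smooth f0 -> smooth f1 -> smooth f2 ->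
  pdiff n (eta3 Lam f0 f1 f2).
Proof.
move=> s0 s1 s2; apply: pdiffM.
  by apply: pdiff_comp => // x; exact: cvg_fst.
apply: pdiffM.
  apply: (pdiff_comp _ _ (@lat1_linear (invmx Lam))) => //.
  exact: lat1_continuous.
apply: (pdiff_comp _ _ (@lat2_linear (invmx Lam))) => //.
exact: lat2_continuous.
Qed.

(** A closed box in the coordinates (x_3, Lam^-1 y); it carries the support of [eta3]. *)
Definition param_box Lam (c s : R) : set (pt3 R) :=
  (fun t : pt3 R => (t.1, lattice_map Lam t.2)) @`
  (`[- c, c]%classic `*` (`[- s, s]%classic `*` `[- s, s]%classic)).

Lemma compact_param_box Lam c s : compact (param_box Lam c s).
Proof.
apply: continuous_compact.
  apply: continuous_subspaceT => x.
  have h : {for x, continuous (fun t : pt3 R => lattice_map Lam t.2)}.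
    by apply: continuous_comp; [exact: cvg_snd|exact: continuous_lattice_map].
  have h1 : {for x, continuous (fun t : pt3 R => t.1)} by exact: cvg_fst.
  exact: (cvg_pair h1 h).
by apply: compact_setX; [|apply: compact_setX]; exact: segment_compact.
Qed.

Lemma param_boxP Lam c s x : Lam \in unitmx ->
  param_box Lam c s x <-> [/\ `|x.1| <= c, `|(lattice_map (invmx Lam) x.2).1| <= s
   & `|(lattice_map (invmx Lam) x.2).2| <= s].
Proof.
move=> uL; split.
  have seg (a b : R) : `[- b, b]%classic a -> `|a| <= b.
    by rewrite /= in_itv/= ler_norml.
  move=> [t [/seg h1 [/seg h2 /seg h3]] <-].
  rewrite -[X in lattice_map (invmx Lam) X]/(lattice_map Lam t.2).
  by rewrite lattice_mapK.
move=> [x1 x2 x3]; exists (x.1, lattice_map (invmx Lam) x.2).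
  by split; [|split] => /=; rewrite in_itv/= -ler_norml.
by rewrite /= lattice_mapVK// -surjective_pairing.
Qed.

Lemma test_function_eta3 Lam f0 f1 f2 (c s : R) : Lam \in unitmx -> c < 2^-1 ->
  smooth f0 -> smooth f1 -> smooth f2 ->
  (forall t, c < `|t| -> f0 t = 0) -> (forall t, s < `|t| -> f1 t = 0) ->
  (forall t, s < `|t| -> f2 t = 0) -> test_function (eta3 Lam f0 f1 f2).
Proof.
move=> uL c2 s0 s1 s2 z0 z1 z2; split.
  by move=> n; apply: pdiff_Ck; exact: pdiff_eta3.
exists (param_box Lam c s); split; first exact: compact_param_box.
  move=> x /(param_boxP _ _ _ uL)[+ _ _] => x1; rewrite /layer/= -ltr_norml.
  exact: le_lt_trans c2.
move=> x /(param_boxP _ _ _ uL)/not_and3P; rewrite /eta3.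
by case=> /negP; rewrite -ltNge => h; [rewrite z0//|rewrite z1//|rewrite z2//];
  rewrite ?(mul0r, mulr0).
Qed.

(** The direction [dir j] lies in the y-plane, so [f0] acts as a mere weight, while the chain rule
    through [invmx Lam] mixes both lattice directions. *)
Lemma derive_eta3 Lam f0 f1 f2 f1' f2' x (j : 'I_3) : smooth f0 ->
  (forall t, is_derive t (1 : R) f1 (f1' t)) ->
  (forall t, is_derive t (1 : R) f2 (f2' t)) -> j != 2%N :> nat ->
  'D_(dir j) (eta3 Lam f0 f1 f2) x =
  (lattice_map (invmx Lam) (dir j).2).1 * eta3 Lam f0 f1' f2 x +
  (lattice_map (invmx Lam) (dir j).2).2 * eta3 Lam f0 f1 f2' x.
Proof.
move=> s0 d1 d2 j2; have [f0' [d0 _]] := s0 1%N.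
have D0 := is_derive_linear_form (dir j) fst_linear (d0 x.1).
have D1 := is_derive_linear_form (dir j) (@lat1_linear (invmx Lam)) (d1 _) (x := x).
have D2 := is_derive_linear_form (dir j) (@lat2_linear (invmx Lam)) (d2 _) (x := x).
have [_ ->] := is_deriveM D0 (is_deriveM D1 D2).
rewrite /eta3 /GRing.scale/= fctE (negbTE j2) mul0r mulr0 addr0.
ring.
Qed.

End Lattice.

(** * Lebesgue measure of the layer and of the box *)

Section Translation.
Context {R : realType}.

Lemma lebesgue_measure_translate (a : R) (A : set R) : measurable A ->
  pushforward (@lebesgue_measure R)
    ((fun x => x + a) : measurableTypeR R -> measurableTypeR R) A =
  lebesgue_measure A.
Proof.
move=> mA; apply/esym/lebesgue_measure_unique => //=.
  by apply: measurable_funD => //; exact: measurable_cst.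
move=> mf _ [[b c]] _ <-.
rewrite /pushforward (_ : _ @^-1` _ = `](b - a), (c - a)]%classic); last first.
  by apply/seteqP; split => x /=; rewrite !in_itv/= ltrBlDr lerBrDr.
by rewrite !lebesgue_measure_itv/= !lte_fin ltrD2r -!EFinB opprB addrA subrK.
Qed.

Lemma measurable_translate_y (v : R * R) :
  measurable_fun [set: mpt R] (fun x => (x.1, x.2 + v) : mpt R).
Proof.
apply: measurable_fun_pair; first exact: measurable_fst.
apply: (@measurable_fun_pair _ _ _ (mpt R) (measurableTypeR R) (measurableTypeR R)
  (fun x => x.2.1 + v.1) (fun x => x.2.2 + v.2)).
  by apply: measurable_funD; [exact: measurable_y1|exact: measurable_cst].
by apply: measurable_funD; [exact: measurable_y2|exact: measurable_cst].
Qed.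

(** By uniqueness of the product measure it is enough to compare on rectangles, where the two
    factors separate. *)
Lemma product_measure_preserving d1 d2 (T1 : measurableType d1)
    (T2 : measurableType d2) (m1 : {sigma_finite_measure set T1 -> \bar R})
    (m2 : {sigma_finite_measure set T2 -> \bar R}) (f1 : T1 -> T1) (f2 : T2 -> T2) :
  measurable_fun setT f1 -> measurable_fun setT f2 ->
  (forall A, measurable A -> m1 (f1 @^-1` A) = m1 A) ->
  (forall A, measurable A -> m2 (f2 @^-1` A) = m2 A) ->
  forall A, measurable A ->
    (m1 \x m2)%E ((fun x => (f1 x.1, f2 x.2)) @^-1` A) = (m1 \x m2)%E A.
Proof.
move=> mf1 mf2 p1 p2 A mA.
have mf : measurable_fun [set: T1 * T2] (fun x => (f1 x.1, f2 x.2)).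
  by apply: measurable_fun_pair;
    [exact: measurableT_comp mf1 measurable_fst
    |exact: measurableT_comp mf2 measurable_snd].
pose m' : {measure set (T1 * T2) -> \bar R} := pushforward (m1 \x m2)%E
  ((fun x => (f1 x.1, f2 x.2))).
rewrite -[LHS]/(m' mf A); apply/esym/product_measure_unique => // B C mB mC.
rewrite -(p1 _ mB) -(p2 _ mC) /m'/= /pushforward.
rewrite -product_measure1E//.
- by rewrite -[X in measurable X]setTI; exact: mf1.
- by rewrite -[X in measurable X]setTI; exact: mf2.
Qed.

Lemma measurable_shift (a : R) :
  measurable_fun [set: measurableTypeR R]
    (fun x => x + a : measurableTypeR R).
Proof. by apply: measurable_funD => //; exact: measurable_cst. Qed.

Lemma leb3_translate (v : R * R) (A : set (mpt R)) : measurable A ->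
  leb3 ((fun x => (x.1, x.2 + v)) @^-1` A) = leb3 A.
Proof.
apply: (product_measure_preserving (m1 := @lebesgue_measure R) (m2 := @leb2 R)
  (f1 := id) (f2 := fun y => y + v)) => //.
  have := @measurable_fun_pair _ _ _ _ (measurableTypeR R) (measurableTypeR R).
  apply; first exact: measurableT_comp (measurable_shift v.1) measurable_fst.
  exact: measurableT_comp (measurable_shift v.2) measurable_snd.
move=> B; exact: (product_measure_preserving (measurable_shift v.1)
  (measurable_shift v.2) (@lebesgue_measure_translate v.1)
  (@lebesgue_measure_translate v.2)).
Qed.

Lemma integral_preserving d (T : measurableType d)
    (mu : {measure set T -> \bar R}) (phi : T -> T) (f : T -> \bar R) :
  measurable_fun setT phi -> (forall A, measurable A -> mu (phi @^-1` A) = mu A) ->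
  measurable_fun setT f -> mu.-integrable setT f ->
  mu.-integrable setT (f \o phi) /\ (\int[mu]_x f (phi x) = \int[mu]_x f x)%E.
Proof.
move=> mphi pres mf intf.
have E (g : T -> \bar R) :
    (\int[mu]_x g x = \int[pushforward mu phi]_x g x)%E.
  by apply: eq_measure_integral => A mA _; rewrite /= /pushforward pres.
have intfT : mu.-integrable setT (f \o phi).
  apply/integrableP; split; first exact: measurableT_comp.
  have /integrableP[_] := intf; rewrite (E (abse \o f)).
  rewrite (ge0_integral_pushforward mphi)//; first exact: measurableT_comp.
  by move=> x _; exact: abse_ge0.
by split => //; rewrite [RHS]E (integral_pushforward mphi).
Qed.

Definition shift_y (v : R * R) (x : pt3 R) : mpt R := (x.1, x.2 + v).

Lemma integral_shift_y (v : R * R) (f : mpt R -> \bar R) :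
  measurable_fun setT f -> (@leb3 R).-integrable setT f ->
  (@leb3 R).-integrable setT (fun x => f (shift_y v x)) /\
  (\int[@leb3 R]_x f (shift_y v x) = \int[@leb3 R]_x f x)%E.
Proof.
exact: (integral_preserving (measurable_translate_y v) (@leb3_translate v)).
Qed.

End Translation.

Lemma integral_prod_fst (R : realType) d1 d2 (T1 : measurableType d1)
    (T2 : measurableType d2) (m1 : {sigma_finite_measure set T1 -> \bar R})
    (m2 : {sigma_finite_measure set T2 -> \bar R}) (A : set T1) (B : set T2)
    (f : T1 -> R) :
  measurable A -> measurable B -> measurable_fun A f -> (forall x, A x -> 0 <= f x) ->
  (\int[m1 \x m2]_(z in A `*` B) (f z.1)%:E = \int[m1]_(x in A) (f x)%:E * m2 B)%E.
Proof.
move=> mA mB mf f0.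
pose F : T1 -> \bar R := (EFin \o f) \_ A.
have mF : measurable_fun setT F.
  by apply/(measurable_restrictT _ mA); exact/measurable_EFinP.
have F0 x : (0 <= F x)%E.
  by rewrite /F patchE; case: ifPn => // /set_mem Ax; rewrite lee_fin f0.
pose h (z : T1 * T2) : \bar R := (F z.1 * (\1_B z.2)%:E)%E.
have mh : measurable_fun setT h.
  apply: emeasurable_funM; first exact: measurableT_comp mF measurable_fst.
  apply/measurable_EFinP.
  have mi : measurable_fun setT (\1_B : T2 -> R) by exact: measurable_indic.
  exact: measurableT_comp mi measurable_snd.
have h0 z : (0 <= h z)%E by rewrite mule_ge0// lee_fin.
transitivity (\int[m1 \x m2]_z h z)%E.
  rewrite integral_mkcond; apply: eq_integral => -[x y] _.
  rewrite patchE /h /F patchE /= indicE in_setX/=.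
  by case: (x \in A); case: (y \in B) => /=; rewrite ?mule1 ?mule0 ?mul0e.
rewrite fubini_tonelli1// [in RHS]integral_mkcond.
rewrite -(ge0_integralZr m1 measurableT mF (fun x _ => F0 x) (measure_ge0 m2 B)).
apply: eq_integral => x _.
have mi : measurable_fun setT (fun y => (\1_B y)%:E : \bar R).
  exact/measurable_EFinP/measurable_indic.
have i0 y : setT y -> (0 <= (\1_B y)%:E :> \bar R)%E by rewrite lee_fin.
rewrite /fubini_F /h /= (ge0_integralZl m2 measurableT mi i0 (F0 x)).
by rewrite integral_indic// setIT.
Qed.

Section Box.
Context {R : realType}.
Implicit Types Lam : 'M[R]_2.

Local Notation half_itv := (`]- 2^-1, 2^-1[%classic : set (measurableTypeR R)).

Lemma integral_half_interval (f F : R -> R) : continuous f ->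
  (forall x, is_derive x (1 : R) F (f x)) ->
  (\int[@lebesgue_measure R]_(x in half_itv) (f x)%:E = (F 2^-1 - F (- 2^-1))%:E)%E.
Proof.
move=> cf dF.
have ab : - 2^-1 < 2^-1 :> R by rewrite gtrN// invr_gt0.
have mf (D : set R) : measurable_fun D (EFin \o f).
  apply/measurable_EFinP; apply: measurable_funTS.
  exact: continuous_measurable_fun.
have cF : continuous F.
  move=> x; apply: differentiable_continuous.
  by apply/derivable1_diffP; case: (dF x).
rewrite integral_itv_bndo_bndc// integral_itv_obnd_cbnd//.
rewrite (continuous_FTC2 (F := F) ab)//.
- exact: continuous_subspaceT.
- split.
  + by move=> x _; case: (dF x).
  + by apply: cvg_at_right_filter; exact: cF.
  + by apply: cvg_at_left_filter; exact: cF.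
- by move=> x _; rewrite derive1E; case: (dF x).
Qed.

Lemma lebesgue_half_interval : (@lebesgue_measure R) half_itv = 1%E.
Proof.
rewrite lebesgue_measure_itv/= lte_fin gtrN ?invr_gt0//.
by rewrite -EFinD opprK; congr EFin; field.
Qed.

Lemma cellP Lam y : Lam \in unitmx -> cell Lam y <->
  - 2^-1 <= (lattice_map (invmx Lam) y).1 < 2^-1 /\
  - 2^-1 <= (lattice_map (invmx Lam) y).2 < 2^-1.
Proof.
move=> uL; split; first by move=> [t [t1 t2] <-]; rewrite lattice_mapK.
move=> [h1 h2]; exists (lattice_map (invmx Lam) y) => //.
by rewrite lattice_mapVK.
Qed.

Definition lat1 Lam (y : R * R) : R := (lattice_map (invmx Lam) y).1.
Definition lat2 Lam (y : R * R) : R := (lattice_map (invmx Lam) y).2.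

Lemma measurable_linear2 (a b : R) (D : set (measurableTypeR R * measurableTypeR R)) :
  measurable_fun D (fun y => a * y.1 + b * y.2).
Proof.
by apply: measurable_funTS; apply: measurable_funD; apply: measurable_funM.
Qed.

Lemma measurable_cell Lam : Lam \in unitmx ->
  measurable (cell Lam : set (measurableTypeR R * measurableTypeR R)).
Proof.
move=> uL.
rewrite (_ : cell Lam = (lat1 Lam @^-1` `[- 2^-1, 2^-1[) `&`
  (lat2 Lam @^-1` `[- 2^-1, 2^-1[)).
  apply: measurableI; rewrite -[X in measurable X]setTI.
    by apply: measurable_linear2 => //; exact: measurable_itv.
  by apply: measurable_linear2 => //; exact: measurable_itv.
apply/seteqP; split => y; rewrite /preimage/= !in_itv/=.
  by move/(cellP _ uL).
by move=> ?; apply/(cellP _ uL).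
Qed.

Lemma boxE Lam : box Lam = half_itv `*` cell Lam.
Proof.
by apply/seteqP; split => -[x y] /= []; rewrite in_itv.
Qed.

Lemma box_layer Lam : box Lam `<=` layer.
Proof. by move=> x []. Qed.

Lemma measurable_box Lam : Lam \in unitmx -> measurable (box Lam : set (mpt R)).
Proof.
move=> uL; rewrite boxE; apply: measurableX; first exact: measurable_itv.
exact: measurable_cell.
Qed.

Lemma bound_lin2 (a b : R) (s : R) (y : R * R) : `|y.1| <= s -> `|y.2| <= s ->
  `|a * y.1 + b * y.2| <= (`|a| + `|b|) * s.
Proof.
move=> h1 h2; apply: le_trans (ler_normD _ _) _; rewrite !normrM mulrDl.
by rewrite lerD// ler_wpM2l.
Qed.

Local Notation square s := (`]- s, s[%classic `*` `]- s, s[%classic).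

Lemma leb2_square (s : R) : 0 < s ->
  @leb2 R (square s) = ((s + s) * (s + s))%:E.
Proof.
move=> s0; have E : (@lebesgue_measure R) `]- s, s[%classic = (s + s)%:E.
  by rewrite lebesgue_measure_itv/= lte_fin gtrN// -EFinD opprK.
rewrite EFinM -E; apply: product_measure1E; exact: measurable_itv.
Qed.

Lemma measurable_square (s : R) :
  measurable (square s : set (measurableTypeR R * measurableTypeR R)).
Proof. by apply: measurableX; exact: measurable_itv. Qed.

Lemma leb2_cell_fin Lam : Lam \in unitmx -> (@leb2 R (cell Lam) < +oo)%E.
Proof.
move=> uL.
(* On arguments with coordinates bounded by 1, each row of [Lam] yields at most the sum of the
   absolute values of its entries; the inner 1 makes the bound strict. *)
pose s := (`|Lam 0 0| + `|Lam 0 1| + (`|Lam 1 0| + `|Lam 1 1|) + 1) * 1.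
have s0 : 0 < s by rewrite /s mulr1 ltr_wpDl// !addr_ge0.
apply: (@le_lt_trans _ _ (@leb2 R (square s))); last first.
  by rewrite leb2_square// ltry.
apply: le_measure; rewrite ?inE; [exact: measurable_cell|exact: measurable_square|].
move=> _ [t [/andP[t1 t1'] /andP[t2 t2']] <-].
have n1 : `|t.1| <= 1.
  by rewrite ler_norml; apply/andP; split; lra.
have n2 : `|t.2| <= 1.
  by rewrite ler_norml; apply/andP; split; lra.
have p00 := normr_ge0 (Lam 0 0). have p01 := normr_ge0 (Lam 0 1).
have p10 := normr_ge0 (Lam 1 0). have p11 := normr_ge0 (Lam 1 1).
split => /=; rewrite in_itv/= -ltr_norml.
  apply: le_lt_trans (bound_lin2 _ _ n1 n2) _; rewrite /s; lra.
apply: le_lt_trans (bound_lin2 _ _ n1 n2) _; rewrite /s; lra.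
Qed.

Lemma leb2_cell_gt0 Lam : Lam \in unitmx -> (0 < @leb2 R (cell Lam))%E.
Proof.
move=> uL; set M := invmx Lam.
pose m := `|M 0 0| + `|M 0 1| + (`|M 1 0| + `|M 1 1|) + 1.
have p00 := normr_ge0 (M 0 0). have p01 := normr_ge0 (M 0 1).
have p10 := normr_ge0 (M 1 0). have p11 := normr_ge0 (M 1 1).
have m0 : 0 < m by rewrite /m; lra.
(* [m] exceeds both absolute row sums of [Lam^-1], so points of a square of half-side 1/(2m) have
   lattice coordinates of size below 1/2. *)
pose s := 2^-1 / m.
have s0 : 0 < s by rewrite divr_gt0// invr_gt0.
apply: (@lt_le_trans _ _ (@leb2 R (square s))).
  by rewrite leb2_square// lte_fin mulr_gt0// addr_gt0.
apply: le_measure; rewrite ?inE; [exact: measurable_square|exact: measurable_cell|].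
move=> y [/=]; rewrite !in_itv/= -!ltr_norml => /ltW y1 /ltW y2.
have key c : c < m -> c * s < 2^-1.
  by move=> cm; rewrite /s mulrCA -[ltRHS]mulr1 ltr_pM2l ?invr_gt0// ltr_pdivrMr// mul1r.
have k1 : `|lat1 Lam y| < 2^-1.
  by apply: le_lt_trans (bound_lin2 _ _ y1 y2) _; apply: key; rewrite /m; lra.
have k2 : `|lat2 Lam y| < 2^-1.
  by apply: le_lt_trans (bound_lin2 _ _ y1 y2) _; apply: key; rewrite /m; lra.
move: k1 k2; rewrite !ltr_norml => /andP[a1 a2] /andP[a3 a4].
by apply/(cellP _ uL); rewrite -/(lat1 Lam y) -/(lat2 Lam y) (ltW a1) a2 (ltW a3) a4.
Qed.

Lemma leb3_box Lam : Lam \in unitmx -> @leb3 R (box Lam) = @leb2 R (cell Lam).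
Proof.
move=> uL; rewrite boxE -[RHS]mul1e -lebesgue_half_interval.
by apply: product_measure1E; [exact: measurable_itv|exact: measurable_cell].
Qed.

(** Tonelli followed by the fundamental theorem of calculus; the sign condition on [f] comes from
    Tonelli. *)
Lemma integral_box_fst Lam (f F : R -> R) : Lam \in unitmx -> continuous f ->
  (forall x, is_derive x (1 : R) F (f x)) ->
  (forall x, - 2^-1 < x < 2^-1 -> 0 <= f x) ->
  (\int[@leb3 R]_(x in box Lam) (f x.1)%:E =
   (F 2^-1 - F (- 2^-1))%:E * @leb3 R (box Lam))%E.
Proof.
move=> uL cf dF f0; rewrite leb3_box//.
rewrite -(integral_half_interval cf dF) boxE.
have mI : measurable half_itv by exact: measurable_itv.
apply: (integral_prod_fst (@lebesgue_measure R) (@leb2 R) mI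
  (measurable_cell uL)).
  by apply: measurable_funTS; exact: continuous_measurable_fun.
by move=> x /=; rewrite in_itv; exact: f0.
Qed.

End Box.

(** * Square-integrable functions *)

Section Integrability.
Context d (T : measurableType d) {R : realType} (mu : {measure set T -> \bar R}).
Implicit Types (D A B : set T) (f g : T -> R).

Lemma Rintegral_support A B f : (forall x, A x -> ~ B x -> f x = 0) ->
  (forall x, B x -> ~ A x -> f x = 0) ->
  \int[mu]_(x in A) f x = \int[mu]_(x in B) f x.
Proof.
move=> AB BA; rewrite Rintegral_mkcond [RHS]Rintegral_mkcond.
apply: eq_Rintegral => x _; rewrite !patchE.
case: ifPn => [/set_mem Ax|/negP Ax]; case: ifPn => [/set_mem Bx|/negP Bx] //.
  by apply: AB => // Bx'; apply: Bx; rewrite inE.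
by apply/esym/BA => // Ax'; apply: Ax; rewrite inE.
Qed.

Definition L2on D f := measurable_fun D f /\
  (\int[mu]_(x in D) (f x ^+ 2)%:E < +oo)%E.

Lemma L2on_sqr D f : measurable D -> L2on D f ->
  mu.-integrable D (EFin \o (fun x => f x ^+ 2)).
Proof.
move=> mD [mf ff]; apply/integrableP; split.
  by apply/measurable_EFinP; exact: measurable_funX.
rewrite (eq_integral (fun x => (f x ^+ 2)%:E))// => x _.
by rewrite /= ger0_norm// sqr_ge0.
Qed.

Lemma le_integrable_EFin D f g : measurable D -> measurable_fun D f ->
  (forall x, D x -> `|f x| <= g x) -> mu.-integrable D (EFin \o g) ->
  mu.-integrable D (EFin \o f).
Proof.
move=> mD mf fg; apply: le_integrable => //; first exact/measurable_EFinP.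
move=> x Dx; rewrite /= lee_fin (le_trans (fg x Dx))//; exact: ler_norm.
Qed.

Lemma integrableD_EFin D f g : measurable D -> mu.-integrable D (EFin \o f) ->
  mu.-integrable D (EFin \o g) -> mu.-integrable D (EFin \o (fun x => f x + g x)).
Proof. by move=> mD fi gi; have := integrableD mD fi gi. Qed.

Lemma integrableZ_EFin D (k : R) f : measurable D -> mu.-integrable D (EFin \o f) ->
  mu.-integrable D (EFin \o (fun x => k * f x)).
Proof. by move=> mD fi; have := integrableZl mD k fi. Qed.

Lemma measurable_integrable D f : mu.-integrable D (EFin \o f) -> measurable_fun D f.
Proof. by move/measurable_int/measurable_EFinP. Qed.

Lemma L2on_mul D f g : measurable D -> L2on D f -> L2on D g ->
  mu.-integrable D (EFin \o (fun x => f x * g x)).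
Proof.
move=> mD f2 g2.
apply: (@le_integrable_EFin _ _ (fun x => f x ^+ 2 + g x ^+ 2)) => //.
- by apply: measurable_funM; [case: f2|case: g2].
- move=> x _; rewrite normrM -(real_normK (num_real (f x))).
  rewrite -(real_normK (num_real (g x))).
  have := sqr_ge0 (`|f x| - `|g x|); rewrite sqrrB.
  have := mulr_ge0 (normr_ge0 (f x)) (normr_ge0 (g x)).
  by rewrite -mulr_natr; lra.
by apply: integrableD_EFin => //; exact: L2on_sqr.
Qed.

Lemma L2on_int D f : measurable D -> (mu D < +oo)%E -> L2on D f ->
  mu.-integrable D (EFin \o f).
Proof.
move=> mD Dfin f2.
have : mu.-integrable D (EFin \o (fun x => f x * 1)).
  apply: L2on_mul => //; split; first exact: measurable_cst.
  by rewrite expr1n integral_cst// mul1e.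
by apply: eq_integrable => // x _; rewrite /= mulr1.
Qed.

Lemma integrable_L2on D f : measurable D -> measurable_fun D f ->
  mu.-integrable D (EFin \o (fun x => f x ^+ 2)) -> L2on D f.
Proof.
move=> mD mf /integrableP[_]; split => //.
move: b; rewrite (eq_integral (fun x => (f x ^+ 2)%:E))// => x _.
by rewrite /= ger0_norm// sqr_ge0.
Qed.

Lemma le_L2on D f (g : T -> R) : measurable D -> measurable_fun D f ->
  (forall x, D x -> f x ^+ 2 <= g x) -> mu.-integrable D (EFin \o g) -> L2on D f.
Proof.
move=> mD mf fg gi; apply: integrable_L2on => //.
apply: le_integrable_EFin gi => //; first exact: measurable_funX.
by move=> x Dx; rewrite ger0_norm ?sqr_ge0// fg.
Qed.

Lemma L2onD D f g : measurable D -> L2on D f -> L2on D g ->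
  L2on D (fun x => f x + g x).
Proof.
move=> mD f2 g2.
apply: (@le_L2on _ _ (fun x => 2 * f x ^+ 2 + 2 * g x ^+ 2)) => //.
- by apply: measurable_funD; [case: f2|case: g2].
- by move=> x _; have := sqr_ge0 (f x - g x); rewrite !expr2; lra.
by apply: integrableD_EFin => //; apply: integrableZ_EFin => //; exact: L2on_sqr.
Qed.

Lemma L2onZ D (k : R) f : measurable D -> L2on D f -> L2on D (fun x => k * f x).
Proof.
move=> mD f2; apply: (@le_L2on _ _ (fun x => k ^+ 2 * f x ^+ 2)) => //.
- by apply: measurable_funM; [exact: measurable_cst|case: f2].
- by move=> x _; rewrite exprMn.
by apply: integrableZ_EFin => //; exact: L2on_sqr.
Qed.

Lemma L2on_bounded D f (M : R) : measurable D -> (mu D < +oo)%E ->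
  measurable_fun D f -> (forall x, D x -> `|f x| <= M) -> L2on D f.
Proof.
move=> mD Dfin mf fM; apply: (@le_L2on _ _ (cst (M ^+ 2))) => //.
  move=> x Dx; rewrite -(real_normK (num_real (f x))).
  by rewrite lerXn2r ?nnegrE// ?fM// (le_trans _ (fM x Dx)).
apply/integrableP; split; first exact/measurable_EFinP/measurable_cst.
have := integral_cst mu mD `|M ^+ 2|%:E.
rewrite /cst /= => ->; rewrite lte_mul_pinfty// lee_fin.
Qed.

Lemma integrable_support D A f : measurable D -> measurable A -> A `<=` D ->
  measurable_fun D f -> (forall x, D x -> ~ A x -> f x = 0) ->
  mu.-integrable A (EFin \o f) -> mu.-integrable D (EFin \o f).
Proof.
move=> mD mA AD mf f0 fi; apply/integrableP; split; first exact/measurable_EFinP.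
have /integrableP[_] := fi.
rewrite integral_mkcond => H; rewrite integral_mkcond.
rewrite (eq_integral (((abse \o (EFin \o f)) \_ A)%E))// => x _.
rewrite !patchE; case: ifPn => [/set_mem Dx|/negP Dx];
  case: ifPn => [/set_mem Ax|/negP Ax] //.
  by rewrite /= f0 ?normr0// => Ax'; apply: Ax; rewrite inE.
by exfalso; apply: Dx; rewrite inE; exact: AD.
Qed.

Lemma ae_imp (P Q : T -> Prop) : {ae mu, forall x, P x} -> (forall x, P x -> Q x) ->
  {ae mu, forall x, Q x}.
Proof. by move=> aP PQ; apply: filterS aP. Qed.

Lemma ae_and (P Q : T -> Prop) : {ae mu, forall x, P x} -> {ae mu, forall x, Q x} ->
  {ae mu, forall x, P x /\ Q x}.
Proof. by move=> aP aQ; apply: filterS2 aP aQ. Qed.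

Lemma ae_eq_Rintegral D f g : measurable D -> measurable_fun D f ->
  measurable_fun D g -> {ae mu, forall x, D x -> f x = g x} ->
  \int[mu]_(x in D) f x = \int[mu]_(x in D) g x.
Proof.
move=> mD mf mg fg; congr fine; apply: ae_eq_integral => //.
- exact/measurable_EFinP.
- exact/measurable_EFinP.
by apply: filterS fg => x h Dx; rewrite h.
Qed.

Lemma dominated_Rintegral D (f_ : nat -> T -> R) f g : measurable D ->
  (forall n, measurable_fun D (f_ n)) -> measurable_fun D f ->
  (forall x, D x -> f_ n x @[n --> \oo] --> f x) ->
  mu.-integrable D (EFin \o g) -> (forall n x, D x -> `|f_ n x| <= g x) ->
  \int[mu]_(x in D) f_ n x @[n --> \oo] --> \int[mu]_(x in D) f x.
Proof.
move=> mD mf_ mf cf gi fg.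
have cE : {ae mu, forall x, D x -> (EFin \o f_ n) x @[n --> \oo] --> (EFin \o f) x}.
  apply: aeW => x Dx; apply/cvg_EFin; last exact: cf.
  exact: nearW.
have bE : {ae mu, forall x n, D x -> (`|(EFin \o f_ n) x| <= (EFin \o g) x)%E}.
  by apply: aeW => x n Dx; rewrite lee_fin fg.
have [fi _ H] := dominated_convergence mD
  (fun n => (measurable_EFinP _ _).2 (mf_ n)) ((measurable_EFinP _ _).2 mf) cE gi bE.
apply: fine_cvg; rewrite fineK//.
exact: integrable_fin_num.
Qed.

End Integrability.

(** * Weak gradients of periodic functions *)

Section WeakGradient.
Context {R : realType}.
Implicit Types (f g eta : pt3 R -> R) (K : set (pt3 R)).

Local Notation mu := (@leb3 R).

Lemma measurable_continuous f : continuous f ->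
  measurable_fun [set: mpt R] f.
Proof.
move=> cf; apply: measurable_fun_open => W oW.
have := @measurable_point_matrix R (fun=> 0) setT ((fun p => f p.1) @^-1` W)
  measurableT.
apply; first by move=> ? ?; exact: measurable_cst.
apply: open_comp oW => p _.
by apply: (continuous_comp (f := fst)); [exact: cvg_fst|exact: cf].
Qed.

Lemma measurable_compact K : compact K -> measurable (K : set (mpt R)).
Proof.
move=> cK; rewrite -[K]setCK; apply: measurableC.
have oK : open (~` K).
  by apply: closed_openC; apply: compact_closed cK; exact: norm_hausdorff.
have := @measurable_point_matrix R (fun=> 0) setT (fst @^-1` (~` K)) measurableT.
rewrite setTI; apply; first by move=> ? ?; exact: measurable_cst.
by apply: open_comp oK => p _; exact: cvg_fst.
Qed.

Lemma pt3_norm_le (x : pt3 R) (r : R) : `|x| <= r ->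
  [/\ `|x.1| <= r, `|x.2.1| <= r & `|x.2.2| <= r].
Proof. by rewrite !prod_normE !ge_max => /andP[-> /andP[-> ->]]. Qed.

Lemma compact_leb3_fin K : compact K -> (mu K < +oo)%E.
Proof.
move=> cK; have [M [_ HM]] := compact_bounded cK.
pose r := `|M| + 1.
have r0 : 0 < r by rewrite ltr_wpDl.
have Mr : M < r by rewrite /r ltr_pwDr// ler_norm.
pose S : set (mpt R) := `]- (r + 1), (r + 1)[%classic `*`
  (`]- (r + 1), (r + 1)[%classic `*` `]- (r + 1), (r + 1)[%classic).
have r10 : 0 < r + 1 by rewrite ltr_wpDl// ltW.
have mS : measurable S.
  by apply: measurableX; [exact: measurable_itv|exact: measurable_square].
apply: (@le_lt_trans _ _ (mu S)).
  apply: le_measure; rewrite ?inE//; first exact: measurable_compact.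
  move=> x Kx; have [h1 h2 h3] := pt3_norm_le (HM r Mr x Kx).
  have w a : `|a| <= r -> `]- (r + 1), (r + 1)[%classic a.
    by move=> ar; rewrite /= in_itv/= -ltr_norml; apply: le_lt_trans ar _; rewrite ltrDl.
  by split; [exact: w|split; exact: w].
rewrite (_ : mu S = (((r + 1) + (r + 1)) *
    (((r + 1) + (r + 1)) * ((r + 1) + (r + 1))))%:E) ?ltry//.
rewrite EFinM -leb2_square//.
have <- : (@lebesgue_measure R) `]- (r + 1), (r + 1)[%classic = ((r + 1) + (r + 1))%:E.
  by rewrite lebesgue_measure_itv/= lte_fin gtrN// -EFinD opprK.
by apply: product_measure1E; [exact: measurable_itv|exact: measurable_square].
Qed.

Lemma L2loc_L2on f K : L2loc f -> compact K -> K `<=` layer -> L2on mu K f.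
Proof.
move=> [mf H] cK Kl; split; last exact: H.
apply: (measurable_funS _ Kl mf); exact: measurable_layer.
Qed.

Lemma continuous_L2on g K : compact K -> continuous g -> L2on mu K g.
Proof.
move=> cK cg.
have [M [_ HM]] : bounded_set (g @` K).
  by apply: compact_bounded; apply: continuous_compact cK; exact: continuous_subspaceT.
apply: (@L2on_bounded _ _ _ mu _ _ (`|M| + 1)).
- exact: measurable_compact.
- exact: compact_leb3_fin.
- by apply: measurable_funTS; exact: measurable_continuous.
- by move=> x Kx; apply: HM; [rewrite ltr_pwDr// ler_norm|exists x].
Qed.

Lemma integrable_compact_support f g K : L2loc f -> continuous g -> compact K ->
  K `<=` layer -> (forall x, ~ K x -> g x = 0) ->
  mu.-integrable layer (EFin \o (fun x => f x * g x)).
Proof.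
move=> lf cg cK Kl g0.
apply: (@integrable_support _ _ _ mu _ K).
- exact: measurable_layer.
- exact: measurable_compact.
- exact: Kl.
- apply: measurable_funM; first by case: lf.
  by apply: measurable_funTS; exact: measurable_continuous.
- by move=> x _ Kx; rewrite g0// mulr0.
- apply: L2on_mul; [exact: measurable_compact|exact: L2loc_L2on|exact: continuous_L2on].
Qed.

Lemma derive_out_support eta K (j : 'I_3) x : compact K ->
  (forall x, ~ K x -> eta x = 0) -> ~ K x -> 'D_(dir j) eta x = 0.
Proof.
move=> cK e0 Kx.
have [_ ->//] : is_derive x (dir j) eta 0.
apply: (@near_eq_is_derive _ _ _ (fun=> 0)).
have oK : open (~` K).
  by apply: closed_openC; apply: compact_closed cK; exact: norm_hausdorff.
by apply: filterS (open_nbhs_nbhs (conj oK Kx)) => y Ky; rewrite e0.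
Qed.

Lemma integrable_test f eta : L2loc f -> test_function eta ->
  mu.-integrable layer (EFin \o (fun x => f x * eta x)) /\
  forall j, mu.-integrable layer (EFin \o (fun x => f x * 'D_(dir j) eta x)).
Proof.
move=> lf [sm [K [cK Kl e0]]]; split.
  by apply: integrable_compact_support cK Kl e0 => //; have := sm 0%N.
move=> j; have [_ H] := sm 1%N; have [_ /= cD] := H j.
exact: (integrable_compact_support lf cD cK Kl
  (fun x => @derive_out_support eta K j x cK e0)).
Qed.

Lemma L2loc_comb (c : R) f g : L2loc f -> L2loc g -> L2loc (fun x => c * f x + g x).
Proof.
move=> lf lg; split.
  apply: measurable_funD; last by case: lg.
  by apply: measurable_funM; [exact: measurable_cst|case: lf].
move=> K cK Kl; have mK := measurable_compact cK.
by have [] := L2onD mK (L2onZ c mK (L2loc_L2on lf cK Kl)) (L2loc_L2on lg cK Kl).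
Qed.

Lemma Rintegral_comb d (T : measurableType d) (nu : {measure set T -> \bar R})
    (A : set T) (c : R) (f g : T -> R) : measurable A ->
  nu.-integrable A (EFin \o f) -> nu.-integrable A (EFin \o g) ->
  \int[nu]_(x in A) (c * f x + g x) =
  c * \int[nu]_(x in A) f x + \int[nu]_(x in A) g x.
Proof.
move=> mA fi gi; rewrite RintegralD//; last exact: integrableZ_EFin.
by rewrite RintegralZl.
Qed.

Lemma weak_gradient_comb (c : R) (phi psi : pt3 R -> 'cV[R]_3)
    (D E : pt3 R -> 'M[R]_3) :
  H1loc phi D -> H1loc psi E ->
  H1loc (fun x => c *: phi x + psi x) (fun x => c *: D x + E x).
Proof.
move=> [p1 D1 w1] [p2 D2 w2]; split.
- move=> i; rewrite (_ : (fun x => _) = (fun x => c * phi x i 0 + psi x i 0)).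
    exact: L2loc_comb.
  by apply/funext => x; rewrite !mxE.
- move=> i j; rewrite (_ : (fun x => _) = (fun x => c * D x i j + E x i j)).
    exact: L2loc_comb.
  by apply/funext => x; rewrite !mxE.
move=> i j eta te.
have [_ /(_ j) i1] := integrable_test (p1 i) te.
have [_ /(_ j) i2] := integrable_test (p2 i) te.
have [i3 _] := integrable_test (D1 i j) te.
have [i4 _] := integrable_test (D2 i j) te.
transitivity (c * \int[mu]_(x in layer) (phi x i 0 * 'D_(dir j) eta x) +
  \int[mu]_(x in layer) (psi x i 0 * 'D_(dir j) eta x)).
  rewrite -(Rintegral_comb c measurable_layer i1 i2).
  by apply: eq_Rintegral => x _; rewrite !mxE mulrDl mulrA.
rewrite (w1 i j eta te) (w2 i j eta te) mulrN -opprD; congr (- _).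
rewrite -(Rintegral_comb c measurable_layer i3 i4).
by apply: eq_Rintegral => x _; rewrite !mxE mulrDl mulrA.
Qed.

End WeakGradient.

(** * Cancellation by periodicity, and the two limits in the cut-offs *)

Section CellAverage.
Context {R : realType}.
Implicit Types (f g : pt3 R -> R) (K : set (pt3 R)).

Local Notation mu := (@leb3 R).

(** A translation in y fixes [x.1], hence the layer. It leaves the integral of [f * g] unchanged,
    and the translated [f] equals [f] almost everywhere. *)
Lemma Rintegral_periodic (Lam : 'M[R]_2) (k : int * int) f g K :
  L2loc f -> ae_periodic Lam f -> continuous g -> compact K -> K `<=` layer ->
  (forall x, ~ K x -> g x = 0) ->
  \int[mu]_(x in layer) (f x * g (translate Lam k x)) =
  \int[mu]_(x in layer) (f x * g x).
Proof.
move=> lf pf cg cK Kl g0.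
set v := lattice_map Lam (k.1%:~R, k.2%:~R).
have fg := integrable_compact_support lf cg cK Kl g0.
pose F : mpt R -> R := (fun x => f x * g x) \_ layer.
have mF : measurable_fun setT F.
  apply/(measurable_restrictT _ measurable_layer).
  exact: measurable_integrable fg.
have mFE : measurable_fun setT (EFin \o F) by exact/measurable_EFinP.
have iF : mu.-integrable setT (EFin \o F).
  have := fg; rewrite (integrable_mkcond _ measurable_layer).
  by rewrite /F restrict_EFin.
have [iT eT] := integral_shift_y v mFE iF.
have eR : \int[mu]_x F (shift_y v x) = \int[mu]_x F x by congr fine.
rewrite [RHS]Rintegral_mkcond -/F -eR.
have FE : (fun x => F (shift_y v x)) =
    (fun x => f (translate Lam k x) * g (translate Lam k x)) \_ layer.
  by apply/funext => x; rewrite /F !patchE.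
have mFT : measurable_fun (layer : set (mpt R)) (fun x => F (shift_y v x)).
  apply: (measurable_funTS (f := F \o shift_y v)).
  exact: measurableT_comp mF (measurable_translate_y v).
have mgT : measurable_fun (layer : set (mpt R)) (fun x => g (translate Lam k x)).
  have mg := measurable_continuous cg.
  apply: (measurable_funTS (f := g \o shift_y v)).
  exact: measurableT_comp mg (measurable_translate_y v).
rewrite FE -Rintegral_mkcond; apply: ae_eq_Rintegral.
- exact: measurable_layer.
- by apply: measurable_funM => //; case: lf.
- apply: eq_measurable_fun mFT => x lx.
  by have /= -> := congr1 (@^~ x) FE; rewrite patchE lx.
by apply: (@ae_imp _ _ _ mu _ _ (pf k)) => x H lx; rewrite H.
Qed.

Lemma continuous_eta3 (Lam : 'M[R]_2) (f0 f1 f2 : R -> R) : continuous f0 ->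
  continuous f1 -> continuous f2 -> continuous (eta3 Lam f0 f1 f2).
Proof.
move=> c0 c1 c2 x.
have d0 : {for x, continuous (fun x : pt3 R => f0 x.1)}.
  by apply: continuous_comp; [exact: cvg_fst|exact: c0].
have d1 : {for x, continuous (fun x : pt3 R => f1 (lattice_map (invmx Lam) x.2).1)}.
  apply: (@continuous_comp _ _ _ (fun x : pt3 R => (lattice_map (invmx Lam) x.2).1)).
    exact: lat1_continuous.
  exact: c1.
have d2 : {for x, continuous (fun x : pt3 R => f2 (lattice_map (invmx Lam) x.2).2)}.
  apply: (@continuous_comp _ _ _ (fun x : pt3 R => (lattice_map (invmx Lam) x.2).2)).
    exact: lat2_continuous.
  exact: c2.
exact: continuousM d0 (continuousM d1 d2).
Qed.

Lemma eta3_support (Lam : 'M[R]_2) (f0 f1 f2 : R -> R) (c s : R) x :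
  Lam \in unitmx ->
  (forall t, c < `|t| -> f0 t = 0) -> (forall t, s < `|t| -> f1 t = 0) ->
  (forall t, s < `|t| -> f2 t = 0) -> ~ param_box Lam c s x ->
  eta3 Lam f0 f1 f2 x = 0.
Proof.
move=> uL z0 z1 z2 /(param_boxP _ _ _ uL)/not_and3P; rewrite /eta3.
by case=> /negP; rewrite -ltNge => h; [rewrite z0//|rewrite z1//|rewrite z2//];
  rewrite ?(mul0r, mulr0).
Qed.

Lemma param_box_layer (Lam : 'M[R]_2) (c s : R) : Lam \in unitmx -> c < 2^-1 ->
  param_box Lam c s `<=` layer.
Proof.
move=> uL c2 x /(param_boxP _ _ _ uL)[+ _ _] => x1; rewrite /layer/= -ltr_norml.
exact: le_lt_trans c2.
Qed.

Lemma lattice_translate (Lam : 'M[R]_2) k x : Lam \in unitmx ->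
  lattice_map (invmx Lam) (translate Lam k x).2 =
  lattice_map (invmx Lam) x.2 + (k.1%:~R, k.2%:~R).
Proof.
move=> uL; rewrite /translate addrC -[lattice_map Lam _]scale1r.
by rewrite lattice_map_linear scale1r lattice_mapK// addrC.
Qed.

Lemma weak_gradient_cutoff (Lam : 'M[R]_2) phi D (f0 h b : R -> R) (c s : R)
    (i j : 'I_3) :
  Lam \in unitmx -> H1loc phi D -> ae_periodic Lam phi -> j != 2%N :> nat ->
  c < 2^-1 -> smooth f0 -> smooth h -> continuous b ->
  (forall t, c < `|t| -> f0 t = 0) -> (forall t, s < `|t| -> h t = 0) ->
  (forall t, s < `|t| -> b t = 0) ->
  (forall t, is_derive t (1 : R) h (b (t + 2^-1) - b (t - 2^-1))) ->
  \int[mu]_(x in layer) (D x i j * eta3 Lam f0 h h x) = 0.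
Proof.
move=> uL [lp lD wg] pp j2 c2 s0 sh cb z0 zh zb dh.
have te : test_function (eta3 Lam f0 h h).
  exact: (@test_function_eta3 _ Lam f0 h h c s).
apply: oppr_inj; rewrite -(wg i j _ te) oppr0.
have h0 : continuous f0 := diffn_continuous (s0 1%N).
have hc : continuous h := diffn_continuous (sh 1%N).
pose bm t := b (t - 2^-1); pose bp t := b (t + 2^-1).
have cshift a : continuous (fun t => b (t + a)).
  move=> t; apply: (@continuous_comp _ _ _ (fun t => t + a) b); last exact: cb.
  by apply: continuousD => //; exact: cst_continuous.
have cbm : continuous bm := cshift _.
have cbp : continuous bp := cshift _.
(* A shift by 1/2 widens the support of [b]. The radius [s + 1] serves both shifts and [h], so that
   one compact set carries all the integrals. *)
have far (t u : R) : `|u| <= 2^-1 -> s + 1 < `|t + u| -> s < `|t|.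
  by move=> u2; have := ler_normD t u; lra.
have n2 : `|2^-1 : R| <= 2^-1 by rewrite ger0_norm// invr_ge0.
have zm t : s + 1 < `|t| -> bm t = 0.
  by move=> st; apply: zb; apply: (far _ 2^-1) => //; rewrite subrK.
have zp t : s + 1 < `|t| -> bp t = 0.
  by move=> st; apply: zb; apply: (far _ (- 2^-1)); rewrite ?normrN// addrK.
have zh1 t : s + 1 < `|t| -> h t = 0.
  by move=> st; apply: zh; apply: lt_trans st; rewrite ltrDl.
have lpi := lp i.
have ppi : ae_periodic Lam (fun x => phi x i 0).
  by move=> k; apply: (@ae_imp _ _ _ mu _ _ (pp k)) => x H lx; rewrite H.
have cK := @compact_param_box R Lam c (s + 1).
have Kl := @param_box_layer Lam c (s + 1) uL c2.
have key (f1 f2 : R -> R) : continuous f1 -> continuous f2 ->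
    (forall t, s + 1 < `|t| -> f1 t = 0) ->
    (forall t, s + 1 < `|t| -> f2 t = 0) ->
    mu.-integrable layer (EFin \o (fun x => phi x i 0 * eta3 Lam f0 f1 f2 x)) /\
    forall k, \int[mu]_(x in layer) (phi x i 0 * eta3 Lam f0 f1 f2 (translate Lam k x)) =
     \int[mu]_(x in layer) (phi x i 0 * eta3 Lam f0 f1 f2 x).
  move=> c1 c2' z1 z2; have ce := continuous_eta3 (Lam := Lam) h0 c1 c2'.
  have ez x := @eta3_support Lam f0 f1 f2 c (s + 1) x uL z0 z1 z2.
  split; first exact: integrable_compact_support lpi ce cK Kl ez.
  by move=> k; exact: Rintegral_periodic lpi ppi ce cK Kl ez.
have [im1 em1] := key bm h cbm hc zm zh1.
have [ip1 _] := key bp h cbp hc zp zh1.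
have [im2 em2] := key h bm hc cbm zh1 zm.
have [ip2 _] := key h bp hc cbp zh1 zp.
set m1 := (lattice_map (invmx Lam) (dir j).2).1.
set m2 := (lattice_map (invmx Lam) (dir j).2).2.
pose I1 (f1 f2 : R -> R) := \int[mu]_(x in layer) (phi x i 0 * eta3 Lam f0 f1 f2 x).
transitivity (m1 * I1 bp h + (- m1 * I1 bm h + (m2 * I1 h bp + - m2 * I1 h bm))).
  have mlay := @measurable_layer R.
  have j2b := integrableZ_EFin (- m2) mlay im2.
  have j2a := integrableD_EFin mlay (integrableZ_EFin m2 mlay ip2) j2b.
  have j1 := integrableD_EFin mlay (integrableZ_EFin (- m1) mlay im1) j2a.
  rewrite -[in - m2 * _](RintegralZl (- m2) mlay im2).
  rewrite -(Rintegral_comb m2 mlay ip2 j2b) -(Rintegral_comb (- m1) mlay im1 j2a).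
  rewrite -(Rintegral_comb m1 mlay ip1 j1).
  apply: eq_Rintegral => x _.
  rewrite (@derive_eta3 R Lam f0 h h _ _ x j s0 dh dh j2) -/m1 -/m2 /eta3 /bp /bm.
  ring.
(* Since [bp t = bm (t + 1)], the two cut-offs differ by the lattice translation (1, 0); for [E2] it
   is (0, 1). *)
have E1 : I1 bp h = I1 bm h.
  rewrite /I1 -(em1 (1, 0)); apply: eq_Rintegral => x _.
  rewrite /eta3 lattice_translate// /bp /bm; case: (lattice_map _ x.2) => t1 t2 /=.
  congr (_ * (_ * (b _ * h _))).
    by rewrite -addrA; congr (_ + _); rewrite -[_%:~R]/(1 : R); field.
  by rewrite addr0.
have E2 : I1 h bp = I1 h bm.
  rewrite /I1 -(em2 (0, 1)); apply: eq_Rintegral => x _.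
  rewrite /eta3 lattice_translate// /bp /bm; case: (lattice_map _ x.2) => t1 t2 /=.
  congr (_ * (_ * (h _ * b _))).
    by rewrite addr0.
  by rewrite -addrA; congr (_ + _); rewrite -[_%:~R]/(1 : R); field.
by rewrite E1 E2; ring.
Qed.


Lemma near_nat_gt (u M : R) : 0 < u -> \forall n \near \oo, M <= n.+1%:R * u.
Proof.
move=> u0; near=> n; rewrite -ler_pdivrMr//.
apply: ltW; rewrite -truncn_le_nat; near: n; exact: nbhs_infty_ge.
Unshelve. all: by end_near. Qed.

(** The sequence is eventually constant: for [u < 0] its argument ends up below -1, for [u >= 0] it
    never leaves the region where [step] is 1. *)
Lemma step_cvg (u : R) : step (n.+1%:R * u) @[n --> \oo] --> ((0 <= u)%R%:R : R).
Proof.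
apply: cvg_near_cst; have [u0|u0] := leP 0 u.
  by apply: nearW => n; rewrite step_eq1// mulr_ge0.
have := @near_nat_gt (- u) 1; rewrite oppr_gt0 => /(_ u0).
apply: filterS => n h; rewrite step_eq0//.
by rewrite lerNr -mulrN.
Qed.

(* Smooth approximation of the indicator of [-1/2, 1/2). Its derivative is the
   difference of two unit translates of one bump, so that it integrates to zero
   against periodic functions. Since [step] equals 1 on all of [0, +oo), the
   convergence to the indicator holds at every point, including the ends. *)
Definition smooth_ind (n : nat) (t : R) : R :=
  step (n.+1%:R * (t + 2^-1)) - step (n.+1%:R * (t - 2^-1)).

Lemma smooth_ind_smooth n : smooth (smooth_ind n).
Proof.
move=> m; have sa (c : R) : diffn m (fun t => step (n.+1%:R * (t + c))).
  apply: (@diffn_ext _ _ (fun t => step (n.+1%:R * t + n.+1%:R * c))).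
    by move=> t; rewrite mulrDr.
  exact/diffn_affine/smooth_step.
apply: diffnD; first exact: sa.
apply: (@diffn_ext _ _ (fun t => -1 * step (n.+1%:R * (t - 2^-1)))).
  by move=> t; rewrite mulN1r.
by apply: diffnM; [exact: diffn_cst|exact: sa].
Qed.

(** The ramps have length 1/(n+1), at most 1, so the support lies in [-3/2, 1/2] for every [n]. A
    radius independent of [n] gives one compact set for dominated convergence. *)
Lemma smooth_ind_support n t : 2 < `|t| -> smooth_ind n t = 0.
Proof.
have n1 : 1 <= n.+1%:R :> R by rewrite ler1n.
rewrite /smooth_ind ltr_normr => /orP[t2|t2].
  by rewrite !step_eq1 ?subrr// mulr_ge0//; lra.
by rewrite !step_eq0 ?subrr//; nra.
Qed.

Lemma smooth_ind_norm n t : `|smooth_ind n t| <= 1.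
Proof.
rewrite /smooth_ind; have := step_ge0 (n.+1%:R * (t + 2^-1)).
have := step_le1 (n.+1%:R * (t + 2^-1)); have := step_ge0 (n.+1%:R * (t - 2^-1)).
have := step_le1 (n.+1%:R * (t - 2^-1)).
by move=> ? ? ? ?; rewrite ler_norml; apply/andP; split; lra.
Qed.

Lemma smooth_ind_cvg t :
  smooth_ind n t @[n --> \oo] --> ((- 2^-1 <= t < 2^-1)%R%:R : R).
Proof.
rewrite (_ : _%:R = (0 <= t + 2^-1)%R%:R - (0 <= t - 2^-1)%R%:R :> R).
  by apply: cvgB; exact: step_cvg.
rewrite subr_ge0 -lerBlDr sub0r; case: (leP 2^-1 t) => [h|h].
  by rewrite (le_trans _ h) ?subrr// lerNl (le_trans (y := 0))// oppr_le0.
by rewrite andbT subr0.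
Qed.

Lemma step_derivative : exists2 s' : R -> R, continuous s' &
  (forall t, is_derive t (1 : R) step (s' t)) /\
  (forall t, 1 < `|t| -> s' t = 0).
Proof.
have [s' [ds sn]] := @smooth_step R 2%N.
exists s'; first exact: diffn_continuous.
split => // t; rewrite ltr_normr => t1.
have [_ <-] := ds t.
have [c H] : exists c : R, \forall x \near t, c = step x.
  case/orP: t1 => t1;
    [exists 1; near=> x; rewrite step_eq1//|exists 0; near=> x; rewrite step_eq0//].
    by apply: ltW; apply: (lt_trans ltr01); near: x; exact: lt_nbhsr.
  by apply: ltW; near: x; apply: lt_nbhsl; rewrite ltrNr.
have [_ ->//] : is_derive t (1 : R) step 0.
exact: (near_eq_is_derive H (is_derive_cst _ _ _)).
Unshelve. all: by end_near. Qed.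

Lemma smooth_ind_derive n : exists2 b : R -> R, continuous b &
  (forall t, 1 < `|t| -> b t = 0) /\
  (forall t, is_derive t (1 : R) (smooth_ind n) (b (t + 2^-1) - b (t - 2^-1))).
Proof.
have [s' cs [ds zs]] := step_derivative.
have n1 : 1 <= n.+1%:R :> R by rewrite ler1n.
(* The derivative of the rescaled step, of which [smooth_ind n] is a difference of two
   translates. *)
exists (fun t => s' (n.+1%:R * t) * n.+1%:R).
  move=> t; apply: cvgM; last exact: cvg_cst.
  apply: (@continuous_comp _ _ _ (fun t : R => n.+1%:R * t) s'); last exact: cs.
  by apply: cvgM => //; exact: cvg_cst.
split.
  move=> t t1; rewrite zs ?mul0r// normrM ger0_norm//.
  by apply: (lt_le_trans t1); rewrite ler_peMl.
move=> t.
have dl (c : R) : is_derive t (1 : R) (fun t => step (n.+1%:R * (t + c)))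
    (s' (n.+1%:R * (t + c)) * n.+1%:R).
  apply: (@is_derive1_comp _ step (fun t => n.+1%:R * (t + c))) => //.
  apply: (is_derive_eq (is_deriveZ _ (is_deriveD (is_derive_id t (1 : R))
    (is_derive_cst c t (1 : R))))).
  by rewrite addr0 /GRing.scale/= mulr1.
exact: (is_deriveB (dl 2^-1) (dl (- 2^-1))).
Qed.

(** Limit of [weak_gradient_cutoff] along [smooth_ind n]. All integrands live on the compact set [K]
    and are dominated there by the absolute value of [D x i j], which is integrable as [D] is
    locally square integrable and [K] has finite measure. *)
Lemma integral_box_cutoff (Lam : 'M[R]_2) phi D (f0 : R -> R) (c : R) (i j : 'I_3) :
  Lam \in unitmx -> H1loc phi D -> ae_periodic Lam phi -> j != 2%N :> nat ->
  c < 2^-1 -> smooth f0 -> (forall t, c < `|t| -> f0 t = 0) ->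
  (forall t, `|f0 t| <= 1) ->
  \int[mu]_(x in box Lam) (D x i j * f0 x.1) = 0.
Proof.
move=> uL H1 pp j2 c2 s0 z0 b0.
pose K := param_box Lam c 2; pose tl (x : pt3 R) := lattice_map (invmx Lam) x.2.
have cK : compact K by exact: compact_param_box.
have mK := measurable_compact cK.
have Kl : K `<=` layer by exact: param_box_layer.
have [_ lD _] := H1; have lDij := lD i j.
pose F n x := D x i j * eta3 Lam f0 (smooth_ind n) (smooth_ind n) x.
pose ind (t : R) : R := (- 2^-1 <= t < 2^-1)%R%:R.
pose G x := D x i j * eta3 Lam f0 ind ind x.
have c0 : continuous f0 := diffn_continuous (s0 1%N).
have cn n : continuous (smooth_ind n) := diffn_continuous (smooth_ind_smooth n 1%N).
have mD : measurable_fun (K : set (mpt R)) (fun x => D x i j).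
  by have [] := L2loc_L2on lDij cK Kl.
have mF n : measurable_fun (K : set (mpt R)) (F n).
  apply: measurable_funM => //; apply: measurable_funTS.
  exact: (measurable_continuous (continuous_eta3 (Lam := Lam) c0 (cn n) (cn n))).
have cF x : K x -> F n x @[n --> \oo] --> G x.
  move=> _; apply: cvgM; first exact: cvg_cst.
  apply: cvgM; first exact: cvg_cst.
  by apply: cvgM; exact: smooth_ind_cvg.
have mG : measurable_fun (K : set (mpt R)) G.
  exact: (measurable_fun_cvg mF cF).
have F0 n : \int[mu]_(x in K) F n x = 0.
  have [b cb [zb db]] := smooth_ind_derive n.
  have zb2 t : 2 < `|t| -> b t = 0 by move=> t2; apply: zb; lra.
  rewrite -(weak_gradient_cutoff i uL H1 pp j2 c2 s0 (smooth_ind_smooth n) cb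
    z0 (@smooth_ind_support n) zb2 db).
  apply: Rintegral_support; first by move=> x Kx /(_ (Kl x Kx)).
  move=> x _ Kx; rewrite /F (eta3_support uL z0 _ _ Kx) ?mulr0//;
    exact: smooth_ind_support.
have bF n x : K x -> `|F n x| <= `|D x i j|.
  move=> _; rewrite normrM ler_piMr// /eta3 !normrM.
  by rewrite mulr_ile1// ?mulr_ile1// ?smooth_ind_norm// mulr_ge0.
have iD : mu.-integrable K (EFin \o (fun x => `|D x i j|)).
  apply: integrable_norm.
  exact: (L2on_int mK (compact_leb3_fin cK) (L2loc_L2on lDij cK Kl)).
have := dominated_Rintegral mK mF mG cF iD bF.
under eq_cvg do rewrite F0.
move=> /(cvg_lim (@Rhausdorff R)); rewrite lim_cst// => G0.
(* Neither set contains the other: [K] exceeds the cell in y, where the indicators vanish, and the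
   box exceeds [K] in x_3, where [f0] vanishes. *)
rewrite [RHS]G0 (_ : \int[mu]_(x in K) G x = \int[mu]_(x in box Lam) G x).
  apply: eq_Rintegral => x /set_mem[_ /(cellP _ uL)[h1 h2]].
  by rewrite /G /eta3 /ind h1 h2 !mulr1.
apply: Rintegral_support => x.
  move=> Kx nb; have lx := Kl x Kx; rewrite /G /eta3 /ind.
  have [h1|_] := boolP (- 2^-1 <= (lattice_map (invmx Lam) x.2).1 < 2^-1);
    last by rewrite mul0r !mulr0.
  have [h2|_] := boolP (- 2^-1 <= (lattice_map (invmx Lam) x.2).2 < 2^-1);
    last by rewrite !mulr0.
  by exfalso; apply: nb; split => //; exact/(cellP _ uL).
move=> [lx /(cellP _ uL)[/andP[h1 h2] /andP[h3 h4]]] nK.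
rewrite /G /eta3 z0 ?mul0r ?mulr0//.
rewrite ltNge; apply/negP => x1; apply: nK; apply/(param_boxP _ _ _ uL).
by split => //; rewrite ler_norml; apply/andP; split; lra.
Qed.

(* A smooth replacement of the weight [x_3] with support inside (-1/2, 1/2). *)
Definition truncation (n : nat) (t : R) : R :=
  t * (step (n.+1%:R * (t + 2^-1) - 2) * step (n.+1%:R * (2^-1 - t) - 2)).

Lemma truncation_smooth n : smooth (truncation n).
Proof.
move=> m; have id1 : diffn m (@idfun R).
  case: m => // m; exists (fun=> 1); split; last exact: diffn_cst.
  by move=> x; exact: is_derive_id.
apply: diffnM => //; apply: diffnM.
  apply: (@diffn_ext _ _ (fun t => step (n.+1%:R * t + (n.+1%:R * 2^-1 - 2)))).
    by move=> t; rewrite mulrDr addrA.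
  exact/diffn_affine/smooth_step.
apply: (@diffn_ext _ _ (fun t => step (- n.+1%:R * t + (n.+1%:R * 2^-1 - 2)))).
  by move=> t; congr step; ring.
exact/diffn_affine/smooth_step.
Qed.

(** At distance at most 1/(n+1) from an end of the interval, the shift by 2 brings the argument of
    one [step] down to -1 or less. For [n = 0] the bound on the left is negative and the truncation
    vanishes identically. *)
Lemma truncation_support n t : 2^-1 - n.+1%:R^-1 < `|t| -> truncation n t = 0.
Proof.
have n0 : 0 < n.+1%:R :> R by rewrite ltr0n.
rewrite /truncation ltr_normr => /orP[t2|t2].
  rewrite (@step_eq0 _ (_ * (2^-1 - t) - 2)) ?mulr0//.
  have : n.+1%:R * (2^-1 - t) <= 1 by
    rewrite -ler_pdivlMl// mulr1; move: (n.+1%:R^-1) t2 => q; lra.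
  by lra.
rewrite (@step_eq0 _ (_ * (t + 2^-1) - 2)) ?mul0r ?mulr0//.
have : n.+1%:R * (t + 2^-1) <= 1 by
    rewrite -ler_pdivlMl// mulr1; move: (n.+1%:R^-1) t2 => q; lra.
by lra.
Qed.

Lemma truncation_norm n t : `|truncation n t| <= 1.
Proof.
have [h|h] := leP `|t| 1.
  rewrite /truncation; move: (step_ge0 (n.+1%:R * (t + 2^-1) - 2))
    (step_le1 (n.+1%:R * (t + 2^-1) - 2)) (step_ge0 (n.+1%:R * (2^-1 - t) - 2))
    (step_le1 (n.+1%:R * (2^-1 - t) - 2)).
  move: (step (_ * (t + _) - _)) (step (_ * (_ - t) - _)) => a b a0 a1 b0 b1.
  rewrite normrM (ger0_norm (mulr_ge0 a0 b0)) -[leRHS]mulr1 ler_pM ?mulr_ge0//.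
  by rewrite mulr_ile1.
rewrite truncation_support ?normr0//.
have : 0 < n.+1%:R^-1 :> R by rewrite invr_gt0 ltr0n.
by move: (n.+1%:R^-1) => q; lra.
Qed.

Lemma truncation_cvg t : - 2^-1 < t < 2^-1 -> truncation n t @[n --> \oo] --> t.
Proof.
move=> /andP[t1 t2]; apply: cvg_near_cst.
have h1 : 0 < t + 2^-1 by lra.
have h2 : 0 < 2^-1 - t by lra.
apply: filterS2 (near_nat_gt 2 h1) (near_nat_gt 2 h2) => n g1 g2.
by rewrite /truncation !step_eq1 ?subr_ge0// !mulr1.
Qed.

(** Each [truncation n] is an admissible weight [f0] in [integral_box_cutoff]. They tend to [x_3]
    and are bounded by 1, so integrability of [D x i j] up to the faces of the box dominates. *)
Lemma integral_box_gradient (Lam : 'M[R]_2) phi D (i j : 'I_3) :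
  Lam \in unitmx -> H1loc phi D -> ae_periodic Lam phi -> j != 2%N :> nat ->
  mu.-integrable (box Lam) (EFin \o (fun x => D x i j)) ->
  \int[mu]_(x in box Lam) (x.1 * D x i j) = 0.
Proof.
move=> uL H1 pp j2 iD.
have mB := measurable_box uL.
have mD := measurable_integrable iD.
pose F n x := D x i j * truncation n x.1.
have F0 n : \int[mu]_(x in box Lam) F n x = 0.
  apply: (integral_box_cutoff i uL H1 pp j2 _ (@truncation_smooth n)
    (@truncation_support n) (@truncation_norm n)).
  by rewrite ltrBlDr ltrDl invr_gt0 ltr0n.
have cF x : box Lam x -> F n x @[n --> \oo] --> D x i j * x.1.
  by move=> [lx _]; apply: cvgM; [exact: cvg_cst|exact: truncation_cvg].
have mF n : measurable_fun (box Lam : set (mpt R)) (F n).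
  apply: measurable_funM => //; apply: measurable_funTS.
  apply: (measurableT_comp (f := truncation n)).
    exact: continuous_measurable_fun (diffn_continuous (truncation_smooth n 1%N)).
  exact: measurable_x3.
have mG : measurable_fun (box Lam : set (mpt R)) (fun x => D x i j * x.1).
  exact: (measurable_fun_cvg mF cF).
have iN := integrable_norm iD.
have bF n x : box Lam x -> `|F n x| <= `|D x i j|.
  by move=> _; rewrite normrM ler_piMr// truncation_norm.
have := dominated_Rintegral mB mF mG cF iN bF.
under eq_cvg do rewrite F0.
move=> /(cvg_lim (@Rhausdorff R)); rewrite lim_cst// => G0.
by rewrite [RHS]G0; apply: eq_Rintegral => x _; rewrite mulrC.
Qed.

End CellAverage.

(** * The energy form *)

Section Frobenius.
Context {R : realType}.

Lemma frob_ge0 m n (F : 'M[R]_(m, n)) : 0 <= frob F F.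
Proof. by apply: sumr_ge0 => i _; apply: sumr_ge0 => j _; rewrite -expr2 sqr_ge0. Qed.

Lemma frob_entry m n (F : 'M[R]_(m, n)) i j : F i j ^+ 2 <= frob F F.
Proof.
rewrite /frob (bigD1 i)//= (bigD1 j)//= expr2 -addrA lerDl addr_ge0//.
  by apply: sumr_ge0 => k _; rewrite -expr2 sqr_ge0.
by apply: sumr_ge0 => k _; apply: sumr_ge0 => l _; rewrite -expr2 sqr_ge0.
Qed.

Lemma sympart_sym n (F : 'M[R]_n) : is_symmx F -> sympart F = F.
Proof.
move=> sF; rewrite /sympart sF (_ : F + F = 2 *: F); last first.
  by rewrite scaler_nat mulr2n.
by rewrite scalerA mulVf ?scale1r.
Qed.

Lemma sympart_is_sym n (F : 'M[R]_n) : is_symmx (sympart F).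
Proof. by apply/matrixP => i j; rewrite !mxE addrC. Qed.

Lemma sympart_comb n (c : R) (F G : 'M[R]_n) :
  sympart (c *: F + G) = c *: sympart F + sympart G.
Proof.
by apply/matrixP => i j; rewrite !mxE; ring.
Qed.

Lemma symmx_comb n (c : R) (F G : 'M[R]_n) :
  is_symmx F -> is_symmx G -> is_symmx (c *: F + G).
Proof.
move=> sF sG; apply/matrixP => i j; rewrite !mxE.
by rewrite -[F in LHS]sF -[G in LHS]sG !mxE.
Qed.

Lemma quad_class_ge0 (alpha beta : R) q : 0 <= alpha -> quad_class alpha beta q ->
  forall F : 'M[R]_3, 0 <= q F.
Proof.
move=> a0 [_ H] F; have /andP[+ _] := H F; apply: le_trans.
by rewrite mulr_ge0// frob_ge0.
Qed.

End Frobenius.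

Section EnergyForm.
Context {R : realType} d (T : measurableType d) (mu : {measure set T -> \bar R}).
Variables (D : set T) (mD : measurable D) (alpha beta : R).
Variable q : T -> 'M[R]_3 -> R.
Hypothesis alpha_ge0 : 0 <= alpha.
Hypothesis measurable_q : forall F : T -> 'M[R]_3,
  (forall i j, measurable_fun D (fun x => F x i j)) ->
  measurable_fun D (fun x => q x (F x)).
Hypothesis quad_q : {ae mu, forall x, D x -> quad_class alpha beta (q x)}.
Implicit Types F U W Z : T -> 'M[R]_3.

Definition L2field F := forall i j, L2on mu D (fun x => F x i j).

Lemma L2field_comb (c : R) F U : L2field F -> L2field U -> L2field (c *: F + U).
Proof.
move=> lF lU i j.
rewrite (_ : (fun x => _) = (fun x => c * F x i j + U x i j)).
  by apply: L2onD => //; exact: L2onZ.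
by apply/funext => x; rewrite fctE !mxE.
Qed.

Lemma L2field_ext F U : (forall x, D x -> F x = U x) -> L2field F -> L2field U.
Proof.
move=> FU lF i j; have [mF fF] := lF i j; split.
  by apply: eq_measurable_fun mF => x /set_mem Dx; rewrite FU.
rewrite (eq_integral (fun x => (F x i j ^+ 2)%:E))// => x /set_mem Dx.
by rewrite FU.
Qed.

Lemma L2field_sympart F : L2field F -> L2field (fun x => sympart (F x)).
Proof.
move=> lF i j.
rewrite (_ : (fun x => _) = (fun x => 2^-1 * (F x i j + F x j i))).
  by apply: L2onZ => //; exact: L2onD.
by apply/funext => x; rewrite !mxE.
Qed.

Lemma integrable_frob F U : L2field F -> L2field U ->
  mu.-integrable D (EFin \o (fun x => frob (F x) (U x))).
Proof.
move=> lF lU; rewrite (_ : EFin \o _ =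
    (fun x => \sum_(i : 'I_3) \sum_(j : 'I_3) (F x i j * U x i j)%:E)%E).
  apply: integrable_sum => // i _; apply: integrable_sum => // j _.
  exact: L2on_mul.
by apply/funext => x; rewrite /= -sumEFin; apply: eq_bigr => i _; rewrite sumEFin.
Qed.

Lemma integrable_energy F : L2field F ->
  mu.-integrable D (EFin \o (fun x => q x (F x))).
Proof.
move=> lF.
have mF : measurable_fun D (fun x => q x (F x)).
  by apply: measurable_q => i j; case: (lF i j).
have lS := L2field_sympart lF.
have iS := integrableZ_EFin beta mD (integrable_frob lS lS).
apply/integrableP; split; first exact/measurable_EFinP.
have /integrableP[_] := iS; apply: le_lt_trans.
apply: ae_ge0_le_integral => //.
- by apply: measurableT_comp => //; exact/measurable_EFinP.
- by apply: measurableT_comp => //; exact: measurable_int iS.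
apply: (ae_imp quad_q) => x H Dx; have qx := H Dx.
rewrite lee_fin ger0_norm ?(quad_class_ge0 alpha_ge0 qx)//.
have [_ /(_ (F x))/andP[_ h]] := qx.
exact: le_trans (ler_norm _).
Qed.

(** The same body as [Lform], over an abstract measure space, so that [ipLE] holds by conversion. *)
Definition bilin x (F U : 'M[R]_3) : R := 2^-1 * (q x (F + U) - q x F - q x U).

Lemma bilinC x (F U : 'M[R]_3) : bilin x F U = bilin x U F.
Proof. by rewrite /bilin (addrC F) addrAC. Qed.

(** Polarization recovers the symmetric part of whichever bilinear form [b] represents [q x]. *)
Lemma bilin_comb x (c : R) (F U W : 'M[R]_3) : quadratic_form (q x) ->
  bilin x (c *: F + U) W = c * bilin x F W + bilin x U W.
Proof.
move=> [b qb]; rewrite /bilin !qb.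
have bDl A1 A2 A3 : b (A1 + A2) A3 = b A1 A3 + b A2 A3 by exact: linearDl.
have bDr A1 A2 A3 : b A3 (A1 + A2) = b A3 A1 + b A3 A2 by exact: linearDr.
have bZl k A1 A2 : b (k *: A1) A2 = k * b A1 A2 by exact: linearZl_LR.
have bZr k A1 A2 : b A1 (k *: A2) = k * b A1 A2 by exact: linearZr_LR.
by rewrite !(bDl, bDr, bZl, bZr); ring.
Qed.

Lemma bilin_diag x (F : 'M[R]_3) : quadratic_form (q x) -> bilin x F F = q x F.
Proof.
move=> [b qb]; rewrite /bilin !qb.
have bDl A1 A2 A3 : b (A1 + A2) A3 = b A1 A3 + b A2 A3 by exact: linearDl.
have bDr A1 A2 A3 : b A3 (A1 + A2) = b A3 A1 + b A3 A2 by exact: linearDr.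
by rewrite !(bDl, bDr); field.
Qed.

Lemma integrable_bilin F U : L2field F -> L2field U ->
  mu.-integrable D (EFin \o (fun x => bilin x (F x) (U x))).
Proof.
move=> lF lU; apply: integrableZ_EFin => //.
have lFU : L2field (fun x => F x + U x).
  apply: L2field_ext (L2field_comb 1 lF lU) => x _.
  by rewrite fctE scale1r.
have i1 := integrable_energy lFU.
have i2 := integrableZ_EFin (-1) mD (integrable_energy lF).
have i3 := integrableZ_EFin (-1) mD (integrable_energy lU).
have := integrableD_EFin mD (integrableD_EFin mD i1 i2) i3.
by apply: eq_integrable => // x _; rewrite /= !mulN1r.
Qed.

Definition energy F U : R := \int[mu]_(x in D) bilin x (F x) (U x).

Lemma energyC F U : energy F U = energy U F.
Proof. by apply: eq_Rintegral => x _; exact: bilinC. Qed.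

Lemma energy_ext F U W Z : (forall x, D x -> F x = W x) ->
  (forall x, D x -> U x = Z x) -> energy F U = energy W Z.
Proof.
by move=> FW UZ; apply: eq_Rintegral => x /set_mem Dx; rewrite FW// UZ.
Qed.

Lemma energy_comb (c : R) F U W : L2field F -> L2field U -> L2field W ->
  energy (c *: F + U) W = c * energy F W + energy U W.
Proof.
move=> lF lU lW; rewrite /energy.
have iF := integrable_bilin lF lW; have iU := integrable_bilin lU lW.
have iFU := integrable_bilin (L2field_comb c lF lU) lW.
rewrite -(Rintegral_comb c mD iF iU); apply: ae_eq_Rintegral => //.
- exact: measurable_integrable iFU.
- apply: (@measurable_integrable _ _ _ mu).
  exact: integrableD_EFin mD (integrableZ_EFin c mD iF) iU.
apply: (ae_imp quad_q) => x H Dx; have [qx _] := H Dx.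
exact: bilin_comb.
Qed.

Lemma energy_diag F : L2field F -> energy F F = \int[mu]_(x in D) q x (F x).
Proof.
move=> lF; apply: ae_eq_Rintegral => //.
- exact: measurable_integrable (integrable_bilin lF lF).
- exact: measurable_integrable (integrable_energy lF).
apply: (ae_imp quad_q) => x H Dx; have [qx _] := H Dx.
exact: bilin_diag.
Qed.

(** The maximum of [f] and [g] dominates [f] everywhere and equals [g] almost everywhere, so a
    pointwise comparison can be followed by an almost everywhere equality. *)
Lemma ae_le_Rintegral (f g : T -> R) : mu.-integrable D (EFin \o f) ->
  mu.-integrable D (EFin \o g) -> {ae mu, forall x, D x -> f x <= g x} ->
  \int[mu]_(x in D) f x <= \int[mu]_(x in D) g x.
Proof.
move=> iF ig fg.
have im : mu.-integrable D (EFin \o (fun x => Num.max (f x) (g x))).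
  apply: (@le_integrable_EFin _ _ _ mu _ _ (fun x => `|f x| + `|g x|)) => //.
  - apply: measurable_maxr; first exact: measurable_integrable iF.
    exact: measurable_integrable ig.
  - by move=> x _; case: (leP (f x) (g x)) => _; rewrite ?lerDl ?lerDr normr_ge0.
  by apply: integrableD_EFin => //; exact: integrable_norm.
apply: (@le_trans _ _ (\int[mu]_(x in D) Num.max (f x) (g x))).
  by apply: le_Rintegral => // x _; rewrite le_max lexx.
rewrite le_eqVlt; apply/orP; left; apply/eqP; apply: ae_eq_Rintegral => //.
- exact: measurable_integrable im.
- exact: measurable_integrable ig.
by apply: (ae_imp fg) => x H Dx; apply/max_idPr; exact: H.
Qed.

Lemma energy_lower F : L2field F ->
  alpha * \int[mu]_(x in D) frob (sympart (F x)) (sympart (F x)) <= energy F F.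
Proof.
move=> lF; have lS := L2field_sympart lF; have iS := integrable_frob lS lS.
rewrite energy_diag// -RintegralZl//; apply: ae_le_Rintegral.
- exact: integrableZ_EFin.
- exact: integrable_energy.
by apply: (ae_imp quad_q) => x H Dx; have [_ /(_ (F x))/andP[]] := H Dx.
Qed.

Lemma energy_upper F : L2field F ->
  energy F F <= beta * \int[mu]_(x in D) frob (sympart (F x)) (sympart (F x)).
Proof.
move=> lF; have lS := L2field_sympart lF; have iS := integrable_frob lS lS.
rewrite energy_diag// -RintegralZl//; apply: ae_le_Rintegral.
- exact: integrable_energy.
- exact: integrableZ_EFin.
by apply: (ae_imp quad_q) => x H Dx; have [_ /(_ (F x))/andP[]] := H Dx.
Qed.

Lemma energy_ge0 F : L2field F -> 0 <= energy F F.
Proof.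
move=> lF; apply: le_trans (energy_lower lF); rewrite mulr_ge0//.
by apply: Rintegral_ge0 => x _; exact: frob_ge0.
Qed.

End EnergyForm.

(** * Orthogonal projection *)

Section OrthogonalProjection.
Context (R : realType) (V : lmodType R).

(** Subspaces as predicates. The empty predicate qualifies, which is why 0 is always obtained from a
    known element. *)
Definition comb_closed (P : V -> Prop) :=
  forall (k : R) u v, P u -> P v -> P (k *: u + v).

Context (L H : V -> Prop) (a : V -> V -> R).
Hypothesis L_comb : comb_closed L.
Hypothesis H_comb : comb_closed H.
Hypothesis H_sub : forall u, H u -> L u.
Hypothesis aC : forall u v, a u v = a v u.
Hypothesis a_comb : forall c u v w, L u -> L v -> L w ->
  a (c *: u + v) w = c * a u w + a v w.
Hypothesis a_ge0 : forall u, L u -> 0 <= a u u.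
Variables b E : 'I_3 -> V.
Hypothesis b_L : forall i, L (b i).
Hypothesis E_sub_b : forall i, H (E i - b i).
Hypothesis E_orth : forall i h, H h -> a (E i) h = 0.
Implicit Types (u v w h : V) (c : 'I_3 -> R).

Lemma comb_closed0 (P : V -> Prop) u :
  comb_closed P -> P u -> P 0.
Proof.
by move=> PC Pu; have := PC (-1) u u Pu Pu; rewrite scaleN1r addNr.
Qed.

Lemma comb_closed_sum (P : V -> Prop) c (v : 'I_3 -> V) :
  comb_closed P -> (forall i, P (v i)) ->
  P (\sum_i c i *: v i).
Proof.
move=> PC Pv; elim/big_rec: _ => [|i u _ Pu]; first exact: comb_closed0 (Pv 0).
exact: PC.
Qed.

Lemma comb_closedB (P : V -> Prop) u v :
  comb_closed P -> P u -> P v -> P (u - v).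
Proof. by move=> PC Pu Pv; rewrite addrC -scaleN1r; exact: PC. Qed.

Lemma comb_closedD (P : V -> Prop) u v :
  comb_closed P -> P u -> P v -> P (u + v).
Proof. by move=> PC Pu Pv; rewrite -[u]scale1r; exact: PC. Qed.

Lemma E_L i : L (E i).
Proof.
by rewrite -(subrK (b i) (E i)); apply: comb_closedD => //; exact: H_sub (E_sub_b _).
Qed.

Lemma aD u v w : L u -> L v -> L w -> a (u + v) w = a u w + a v w.
Proof. by move=> lu lv lw; rewrite -[u]scale1r a_comb// mul1r scale1r. Qed.

Lemma aB u v w : L u -> L v -> L w -> a (u - v) w = a u w - a v w.
Proof. by move=> lu lv lw; rewrite addrC -scaleN1r a_comb// mulN1r addrC. Qed.

Lemma a_sum c (v : 'I_3 -> V) w : (forall i, L (v i)) -> L w ->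
  a (\sum_i c i *: v i) w = \sum_i c i * a (v i) w.
Proof.
move=> Lv lw.
suff [] : L (\sum_i c i *: v i) /\
  a (\sum_i c i *: v i) w = \sum_i c i * a (v i) w by [].
elim/big_rec2: _ => [|i y u _ [Lu aE]].
  have L0 := comb_closed0 L_comb lw; split => //.
  by have := a_comb (-1) lw lw lw; rewrite scaleN1r addNr mulN1r addNr.
by split; [exact: L_comb|rewrite a_comb// aE].
Qed.

(** The difference [E k - b k] lies in [H], to which [E i] is orthogonal. *)
Lemma a_E_b i k : a (E i) (b k) = a (E i) (E k).
Proof.
rewrite -[X in _ = a _ X](subrK (b k)) aC [RHS]aC
  (aD (H_sub (E_sub_b k)) (b_L k) (E_L i)).
by rewrite [a (E k - _) _]aC E_orth// add0r.
Qed.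

Lemma a_E_sym i k : a (E i) (b k) = a (E k) (b i).
Proof. by rewrite !a_E_b aC. Qed.

Lemma E_comb_orth c h : H h -> a (\sum_i c i *: E i) h = 0.
Proof.
move=> Hh; rewrite a_sum//; [|exact: E_L|exact: H_sub].
by rewrite big1// => i _; rewrite E_orth// mulr0.
Qed.

Lemma L_E_comb c : L (\sum_i c i *: E i).
Proof. exact: comb_closed_sum L_comb E_L. Qed.

Lemma a_E_comb c : a (\sum_i c i *: E i) (\sum_i c i *: E i) =
  \sum_i \sum_j a (E i) (b j) * c i * c j.
Proof.
rewrite a_sum//; [|exact: E_L|exact: L_E_comb].
apply: eq_bigr => i _; rewrite aC a_sum//; [|exact: E_L|exact: E_L].
by rewrite mulr_sumr; apply: eq_bigr => j _; rewrite a_E_b aC; ring.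
Qed.

Lemma E_comb_sub c : H (\sum_i c i *: E i - \sum_i c i *: b i).
Proof.
rewrite -sumrB; under eq_bigr do rewrite -scalerBr.
exact: comb_closed_sum.
Qed.

(** Pythagoras: the competitor is the combination of the [E i] plus an element of [H], and the cross
    term vanishes. *)
Lemma E_comb_min c h : H h ->
  a (\sum_i c i *: E i) (\sum_i c i *: E i) <=
  a (\sum_i c i *: b i + h) (\sum_i c i *: b i + h).
Proof.
move=> Hh; set e := \sum_i c i *: E i; set f := \sum_i c i *: b i.
have Hd : H (h - (e - f)) by apply: comb_closedB => //; exact: E_comb_sub.
rewrite (_ : f + h = e + (h - (e - f))); last first.
  by rewrite opprB [h + _]addrC addrA [e + _]addrC subrK.
move: (h - (e - f)) Hd => g Hg.
have le : L e by exact: L_E_comb.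
have lg := H_sub Hg; have leg := comb_closedD L_comb le lg.
rewrite (aD le lg leg) [a e (e + g)]aC [a g (e + g)]aC (aD le lg le) (aD le lg lg).
rewrite [a g e]aC (E_comb_orth _ Hg) addr0 add0r.
by rewrite lerDl a_ge0.
Qed.

(** Otherwise the value of the form at [t *: u + v], a quadratic polynomial in [t] without constant
    term, would be negative for some small [t]. *)
Lemma a_null_orth u v : L u -> L v -> a v v = 0 -> a u v = 0.
Proof.
move=> lu lv v0; apply/eqP/contraT => uv0.
have pos t : 0 <= t ^+ 2 * a u u + 2 * t * a u v.
  have := a_ge0 (L_comb t lu lv).
  have ltuv := L_comb t lu lv.
  rewrite a_comb// [a u _]aC [a v (_ + _)]aC !a_comb// v0 [a v u]aC addr0.
  by move=> H0; apply: le_trans H0 _; rewrite le_eqVlt; apply/orP; left; apply/eqP; ring.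
have := a_ge0 lu; set A := a u u in pos *; set B := a u v in pos uv0 *.
move=> A0.
have B2 : 0 < B ^+ 2 by rewrite exprn_even_gt0.
(* The minimizer would be [- B / A]; adding 1 to the denominator covers [A = 0] and still gives a
   negative value. *)
have := pos (- B / (A + 1)).
have A1 : 0 < A + 1 by rewrite ltr_wpDl.
rewrite (_ : _ + _ = - (B ^+ 2 * (A + 2) / (A + 1) ^+ 2)); last first.
  by field; rewrite gt_eqF.
rewrite oppr_ge0 leNgt divr_gt0 ?exprn_gt0// mulr_gt0//.
by rewrite ltr_wpDl.
Qed.

(** A field [F] orthogonal to [H] agrees, up to a null vector, with the combination [ed] of the
    [E i] having the same bending coefficients [d]. Orthogonality to [F] thus reduces to
    orthogonality to each [E j], which is the linear system for [c]. *)
Lemma E_comb_is_proj u c (F : V) d h : L u ->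
  (forall j, \sum_i c i * a (E i) (b j) = a u (E j)) ->
  F = \sum_i d i *: b i + h -> H h -> (forall k, H k -> a F k = 0) ->
  a (\sum_i c i *: b i - \sum_i c i *: E i) F = 0 /\
  a (u - \sum_i c i *: E i) F = 0.
Proof.
move=> lu cE FE Hh Fo.
have HE := E_comb_sub d.
split.
  rewrite aC -opprB -scaleN1r.
  suff Hm : H (-1 *: (\sum_i c i *: E i - \sum_i c i *: b i)) by exact: Fo.
  rewrite -[_ *: _]addr0; apply: H_comb; first exact: E_comb_sub.
  exact: comb_closed0 H_comb Hh.
have lF : L F.
  rewrite FE; apply: comb_closedD => //; last exact: H_sub.
  exact: comb_closed_sum.
set ed := \sum_i d i *: E i; set w := u - _.
have led : L ed by exact: L_E_comb.
have HZ : H (F - ed).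
  rewrite FE (_ : _ - _ = h - (ed - \sum_i d i *: b i)).
    by apply: comb_closedB => //; exact: E_comb_sub.
  by rewrite opprB addrCA addrA.
have lZ := H_sub HZ.
have lw : L w by apply: comb_closedB => //; exact: L_E_comb.
(* [F - ed] belongs to [H], and both [F] and [ed] are orthogonal to [H]. *)
have Z0 : a (F - ed) (F - ed) = 0.
  by rewrite aB// Fo// E_comb_orth// subr0.
rewrite -(subrK ed F) aC aD// [a (F - ed) w]aC (a_null_orth lw lZ Z0) add0r.
rewrite /ed a_sum//; last exact: E_L.
rewrite big1// => j _; rewrite aC /w aB//; [|exact: L_E_comb|exact: E_L].
rewrite -cE a_sum//; [|exact: E_L|exact: E_L].
by under [X in _ - X]eq_bigr do rewrite -a_E_b; rewrite subrr mulr0.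
Qed.

Lemma proj_E_coef u c v j : L u -> L v ->
  a (\sum_i c i *: b i - v) (E j) = 0 -> a (u - v) (E j) = 0 ->
  \sum_i c i * a (E i) (b j) = a u (E j).
Proof.
move=> lu lv; have lE := E_L j.
have lb : L (\sum_i c i *: b i) by exact: comb_closed_sum.
rewrite !aB// => /eqP; rewrite subr_eq0 => /eqP h1 /eqP.
rewrite subr_eq0 => /eqP ->; rewrite -h1 a_sum//.
by apply: eq_bigr => i _; rewrite a_E_sym [a (b i) _]aC.
Qed.

End OrthogonalProjection.

(** * Relaxation strains and bending strains *)

Section RelaxationSpace.
Context {R : realType}.
Variables (gamma : R) (Lam : 'M[R]_2).
Hypotheses (gamma_gt0 : 0 < gamma) (uL : Lam \in unitmx).
Implicit Types (G M : 'M[R]_2) (phi psi : pt3 R -> 'cV[R]_3)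
  (D E F U : pt3 R -> 'M[R]_3).

Local Notation mu := (@leb3 R).
Local Notation L2 := (L2field mu (box Lam : set (mpt R))).

Let mB : measurable (box Lam : set (mpt R)) := measurable_box uL.

Lemma measurable_box_layer (f : pt3 R -> R) :
  measurable_fun layer f -> measurable_fun (box Lam : set (mpt R)) f.
Proof.
by move=> mf; apply: (measurable_funS _ (@box_layer _ Lam) mf); exact: measurable_layer.
Qed.

Lemma measurable_frob m n (F : pt3 R -> 'M[R]_(m, n)) (A : set (mpt R)) :
  (forall i j, measurable_fun A (fun x => F x i j)) ->
  measurable_fun A (fun x => frob (F x) (F x)).
Proof.
move=> mF; apply: measurable_sum => i; apply: measurable_sum => j.
exact: (measurable_funM (mF i j) (mF i j)).
Qed.

Lemma integrable_frob_box m n (F : pt3 R -> 'M[R]_(m, n)) :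
  (forall i j, L2on mu (box Lam : set (mpt R)) (fun x => F x i j)) ->
  mu.-integrable (box Lam) (EFin \o (fun x => frob (F x) (F x))).
Proof.
move=> lF; rewrite (_ : EFin \o _ =
    (fun x => \sum_i \sum_j (F x i j * F x i j)%:E)%E).
  apply: integrable_sum => // i _; apply: integrable_sum => // j _.
  exact: L2on_mul.
by apply/funext => x; rewrite /= -sumEFin; apply: eq_bigr => i _; rewrite sumEFin.
Qed.

Lemma frob_finite_L2on m n (F : pt3 R -> 'M[R]_(m, n)) :
  (forall i j, measurable_fun (box Lam : set (mpt R)) (fun x => F x i j)) ->
  (\int[mu]_(x in box Lam) (frob (F x) (F x))%:E < +oo)%E ->
  forall i j, L2on mu (box Lam : set (mpt R)) (fun x => F x i j).
Proof.
move=> mF fF i j; apply: le_L2on (mB) (mF i j) (fun x _ => frob_entry (F x) i j) _.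
have mf := measurable_frob mF.
apply/integrableP; split; first exact/measurable_EFinP.
rewrite (eq_integral (fun x : mpt R => (frob (F x) (F x))%:E))// => x _.
by rewrite /= ger0_norm ?frob_ge0.
Qed.

Lemma nabla_entry D x i j :
  nabla gamma D x i j = (if j == 2%N :> nat then gamma^-1 else 1) * D x i j.
Proof. by rewrite mxE. Qed.

(** As [gamma] is nonzero, the weighted norm is finite exactly when all entries are square
    integrable; in this form the condition is visibly stable under linear combinations. *)
Lemma H1gammaP phi D : H1gamma gamma Lam phi D <->
  [/\ H1loc phi D, ae_periodic Lam phi,
      forall i, L2on mu (box Lam : set (mpt R)) (fun x => phi x i 0)
    & L2 D].
Proof.
have mphi : H1loc phi D -> forall i j,
    measurable_fun (box Lam : set (mpt R)) (fun x => phi x i j).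
  by move=> [p _ _] i j; rewrite (ord1 j); exact: (measurable_box_layer (proj1 (p i))).
have mD : H1loc phi D -> forall i j,
    measurable_fun (box Lam : set (mpt R)) (fun x => D x i j).
  by move=> [_ d _] i j; exact: (measurable_box_layer (proj1 (d i j))).
have mN : H1loc phi D -> forall i j,
    measurable_fun (box Lam : set (mpt R)) (fun x => nabla gamma D x i j).
  move=> h i j; apply: (eq_measurable_fun (fun x : mpt R =>
    (if j == 2%N :> nat then gamma^-1 else 1) * D x i j)).
    by move=> x _; rewrite nabla_entry.
  by apply: measurable_funM; [exact: measurable_cst|exact: mD].
split=> [[h pp fin]|[h pp lp lD]].
  have le1 (f g : pt3 R -> R) : measurable_fun (box Lam : set (mpt R)) f ->
      measurable_fun (box Lam : set (mpt R)) g -> (forall x, 0 <= f x) ->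
      (forall x, f x <= g x) ->
      (\int[mu]_(x in box Lam) (g x)%:E < +oo)%E ->
      (\int[mu]_(x in box Lam) (f x)%:E < +oo)%E.
    move=> mf mg f0 fg; apply: le_lt_trans; apply: ge0_le_integral => //.
    - by move=> x _; rewrite lee_fin.
    - exact/measurable_EFinP.
    - exact/measurable_EFinP.
    - by move=> x _; rewrite lee_fin.
  have mt := measurable_funD (measurable_frob (mphi h)) (measurable_frob (mN h)).
  have lN : L2 (nabla gamma D).
    apply: frob_finite_L2on; first exact: mN.
    apply: le1 fin => //; first exact: measurable_frob (mN h).
    - by move=> x; exact: frob_ge0.
    - by move=> x; rewrite lerDr frob_ge0.
  split => //.
    move=> i; apply: (frob_finite_L2on (mphi h)).
    apply: le1 fin => //; first exact: measurable_frob (mphi h).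
    - by move=> x; exact: frob_ge0.
    - by move=> x; rewrite lerDl frob_ge0.
  move=> i j.
  rewrite (_ : (fun x => D x i j) = (fun x =>
      (if j == 2%N :> nat then gamma else 1) * nabla gamma D x i j)).
    exact: L2onZ.
  apply/funext => x; rewrite nabla_entry; case: ifP => _; rewrite ?mul1r//.
  by rewrite mulrA mulfV ?mul1r// gt_eqF.
split => //.
have lN : L2 (nabla gamma D).
  move=> i j; rewrite (_ : (fun x => _) = (fun x =>
    (if j == 2%N :> nat then gamma^-1 else 1) * D x i j)); first exact: L2onZ.
  by apply/funext => x; rewrite nabla_entry.
have lp' : forall i j, L2on mu (box Lam : set (mpt R)) (fun x => phi x i j).
  by move=> i j; rewrite ord1.
have := integrableD_EFin mB (integrable_frob_box lp') (integrable_frob_box lN).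
move=> /integrableP[_]; rewrite (eq_integral (fun x : mpt R =>
  (frob (phi x) (phi x) + frob (nabla gamma D x) (nabla gamma D x))%:E))// => x _.
by rewrite /= ger0_norm// addr_ge0 ?frob_ge0.
Qed.

Lemma ae_periodic_comb m n (c : R) (F U : pt3 R -> 'M[R]_(m, n)) :
  ae_periodic Lam F -> ae_periodic Lam U ->
  ae_periodic Lam (fun x => c *: F x + U x).
Proof.
move=> pF pU k; apply: (ae_imp (ae_and (mu := mu) (pF k) (pU k))) => x [h1 h2] lx.
by rewrite h1// h2.
Qed.

Lemma H1gamma_comb (c : R) phi psi D E :
  H1gamma gamma Lam phi D -> H1gamma gamma Lam psi E ->
  H1gamma gamma Lam (fun x => c *: phi x + psi x) (fun x => c *: D x + E x).
Proof.
move=> /H1gammaP[h1 p1 l1 d1] /H1gammaP[h2 p2 l2 d2]; apply/H1gammaP; split.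
- exact: weak_gradient_comb.
- exact: ae_periodic_comb.
- move=> i; rewrite (_ : (fun x => _) = (fun x => c * phi x i 0 + psi x i 0)).
    by apply: L2onD => //; exact: L2onZ.
  by apply/funext => x; rewrite !mxE.
- exact: L2field_comb.
Qed.

Lemma embed3Z (c : R) G : embed3 (c *: G) = c *: embed3 G.
Proof.
have E : block_mx (c *: G) 0 0 0 = c *: block_mx G 0 0 0 :> 'M[R]_(2 + 1).
  by rewrite scale_block_mx !scaler0.
exact: E.
Qed.

Lemma embed3_comb (c : R) G M : embed3 (c *: G + M) = c *: embed3 G + embed3 M.
Proof.
have E : block_mx (c *: G + M) 0 0 0 =
    c *: block_mx G 0 0 0 + block_mx M 0 0 0 :> 'M[R]_(2 + 1).
  by rewrite scale_block_mx add_block_mx !scaler0 !addr0.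
exact: E.
Qed.

Lemma rel_strain_comb (c : R) M N D E x :
  rel_strain gamma (c *: M + N) (fun x => c *: D x + E x) x =
  c *: rel_strain gamma M D x + rel_strain gamma N E x.
Proof.
rewrite /rel_strain embed3_comb.
rewrite (_ : nabla gamma (fun x => c *: D x + E x) x =
  c *: nabla gamma D x + nabla gamma E x); last first.
  by apply/matrixP => i j; rewrite !mxE; ring.
by rewrite sympart_comb scalerDr addrACA.
Qed.

Lemma Hrel_comb : comb_closed (Hrel gamma Lam).
Proof.
move=> c F U [M [phi [D [sM h FE]]]] [N [psi [E [sN k UE]]]].
exists (c *: M + N), (fun x => c *: phi x + psi x), (fun x => c *: D x + E x).
split; [exact: symmx_comb|exact: H1gamma_comb|].
by move=> x lx; rewrite rel_strain_comb -FE// -UE.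
Qed.

Lemma box_fin : (mu (box Lam) < +oo)%E.
Proof. by rewrite leb3_box// leb2_cell_fin. Qed.

Lemma L2on_cst (c : R) : L2on mu (box Lam : set (mpt R)) (fun=> c).
Proof.
by apply: (@L2on_bounded _ _ _ mu _ _ `|c|) => //; exact: box_fin.
Qed.

Lemma L2on_x3 : L2on mu (box Lam : set (mpt R)) (fun x => x.1).
Proof.
apply: (@L2on_bounded _ _ _ mu _ _ 1) => //; first exact: box_fin.
  exact: measurable_x3.
by move=> x [/andP[h1 h2] _]; rewrite ler_norml; apply/andP; split; lra.
Qed.

Lemma bending_entry G x i j : bending G x i j = x.1 * embed3 G i j.
Proof. by rewrite /bending embed3Z mxE.
Qed.

Lemma L2_bending G : L2 (bending G).
Proof.
move=> i j; rewrite (_ : (fun x => _) = (fun x => embed3 G i j * x.1)).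
  by apply: L2onZ => //; exact: L2on_x3.
by apply/funext => x; rewrite bending_entry mulrC.
Qed.

Lemma L2_rel_strain M phi D : H1gamma gamma Lam phi D -> L2 (rel_strain gamma M D).
Proof.
move=> /H1gammaP[_ _ _ lD].
have lN : L2 (nabla gamma D).
  move=> i j; rewrite (_ : (fun x => _) = (fun x =>
    (if j == 2%N :> nat then gamma^-1 else 1) * D x i j)); first exact: L2onZ.
  by apply/funext => x; rewrite nabla_entry.
have lS := L2field_sympart mB lN.
move=> i j; rewrite (_ : (fun x => _) = (fun x =>
    embed3 M i j + sympart (nabla gamma D x) i j)).
  by apply: L2onD => //; exact: L2on_cst.
by apply/funext => x; rewrite mxE.
Qed.

Lemma L2_Hrel F : Hrel gamma Lam F -> L2 F.
Proof.
move=> [M [phi [D [sM h FE]]]]; apply: L2field_ext (L2_rel_strain M h) => x bx.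
by rewrite FE//; exact: box_layer bx.
Qed.

End RelaxationSpace.

(** * Moments of x_3 over the box and the L^2 lower bound for strains *)

Section BendingBounds.
Context {R : realType}.
Variables (gamma : R) (Lam : 'M[R]_2).
Hypotheses (gamma_gt0 : 0 < gamma) (uL : Lam \in unitmx).
Implicit Types (G M : 'M[R]_2) (F U : pt3 R -> 'M[R]_3).

Local Notation mu := (@leb3 R).
Local Notation vol := (fine (@leb3 R (box Lam))).
Local Notation L2 := (L2field mu (box Lam : set (mpt R))).

Let mB : measurable (box Lam : set (mpt R)) := measurable_box uL.

Lemma leb3_boxE : @leb3 R (box Lam) = vol%:E.
Proof. by rewrite fineK// ge0_fin_numE ?box_fin. Qed.

Lemma vol_gt0 : 0 < vol.
Proof. by rewrite -lte_fin -leb3_boxE leb3_box// leb2_cell_gt0. Qed.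

Lemma Rintegral_sum d (T : measurableType d) (nu : {measure set T -> \bar R})
    (A : set T) (I : finType) (f : I -> T -> R) : measurable A ->
  (forall i, nu.-integrable A (EFin \o f i)) ->
  \int[nu]_(x in A) (\sum_i f i x) = \sum_i \int[nu]_(x in A) f i x.
Proof.
move=> mA fi.
pose P (g : T -> R) (r : R) :=
  nu.-integrable A (EFin \o g) /\ \int[nu]_(x in A) g x = r.
have -> : (fun x => \sum_i f i x) = \sum_i f i.
  by apply/funext => x; rewrite fct_sumE.
suff H : P (\sum_i f i) (\sum_i \int[nu]_(x in A) f i x) by case: H.
apply: (big_rec2 P) => [|i g r _ [ig eg]].
  split; first exact: integrable0.
  by rewrite /Rintegral integral0.
split; first exact: integrableD_EFin.
by rewrite (RintegralD mA (fi i) ig) eg.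
Qed.

(** The integral of t^2 over (-1/2, 1/2) is 1/12: the origin of the 12 in the bounds on [Qhat]. *)
Lemma integral_box_x3sqr : \int[mu]_(x in box Lam) (x.1 ^+ 2) = vol / 12.
Proof.
have c2 : continuous (fun t : R => t ^+ 2) by exact: exprn_continuous.
have dF x : is_derive x (1 : R) (fun t : R => 3^-1 * t ^+ 3) (x ^+ 2).
  have := is_deriveZ (3^-1 : R) (is_deriveX 3 (is_derive_id x (1 : R))).
  move=> H; apply: (is_derive_eq H).
  by rewrite /GRing.scale/= mulr1 mulrA mulVf ?mul1r// pnatr_eq0.
rewrite /Rintegral (integral_box_fst uL c2 dF).
  by rewrite leb3_boxE -EFinM /=; field.
by move=> x _; exact: sqr_ge0.
Qed.

(** [integral_box_fst] handles nonnegative integrands, so [x.1 + 2^-1] is integrated and the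
    constant subtracted. *)
Lemma integral_box_x3 : \int[mu]_(x in box Lam) x.1 = 0.
Proof.
have c1 : continuous (fun t : R => t + 2^-1).
  by move=> t; apply: cvgD; [exact: cvg_id|exact: cvg_cst].
have dF x : is_derive x (1 : R) (fun t : R => 2^-1 * t ^+ 2 + 2^-1 * t) (x + 2^-1).
  have H := is_deriveD (is_deriveZ (2^-1 : R) (is_deriveX 2 (is_derive_id x (1 : R))))
    (is_deriveZ (2^-1 : R) (is_derive_id x (1 : R))).
  by apply: (is_derive_eq H); rewrite /GRing.scale/=; field.
have i1 := L2on_int mB (box_fin uL) (L2on_x3 uL).
have i2 := L2on_int mB (box_fin uL) (L2on_cst uL 2^-1).
have E := RintegralD mB i1 i2.
have E2 : \int[mu]_(x in box Lam) (x.1 + 2^-1) = vol / 2.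
  rewrite /Rintegral (integral_box_fst uL c1 dF).
    by rewrite leb3_boxE -EFinM /=; field.
  by move=> x /andP[h _]; lra.
have E3 : \int[mu]_(x in box Lam) (2^-1 : R) = vol / 2.
  by rewrite (Rintegral_cst mu mB) mulrC.
by move: E; rewrite E2 E3 => /eqP; rewrite -subr_eq subrr => /eqP.
Qed.

Lemma frob_block (A : 'M[R]_(2 + 1)) :
  frob (ulsubmx A) (ulsubmx A) <= frob A A.
Proof.
rewrite /frob big_split_ord /= -[leLHS]addr0 lerD//; last first.
  by apply: sumr_ge0 => i _; apply: sumr_ge0 => j _; rewrite -expr2 sqr_ge0.
apply: ler_sum => i _; rewrite big_split_ord /= -[leLHS]addr0 lerD//.
  by apply: ler_sum => j _; rewrite !mxE.
by apply: sumr_ge0 => j _; rewrite -expr2 sqr_ge0.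
Qed.

Lemma embed3_ul G (i j : 'I_2) :
  embed3 G (lshift 1 i : 'I_(2 + 1)) (lshift 1 j : 'I_(2 + 1)) = G i j.
Proof. exact: (block_mxEul G 0 0 0 i j). Qed.

Lemma embed3_ur G (i : 'I_2) (j : 'I_1) :
  embed3 G (lshift 1 i : 'I_(2 + 1)) (rshift 2 j : 'I_(2 + 1)) = 0.
Proof.
have z : (0 : 'M[R]_(2, 1)) i j = 0 by rewrite mxE.
exact: etrans (block_mxEur G 0 0 0 i j) z.
Qed.

Lemma embed3_dl G (i : 'I_1) (j : 'I_2) :
  embed3 G (rshift 2 i : 'I_(2 + 1)) (lshift 1 j : 'I_(2 + 1)) = 0.
Proof.
have z : (0 : 'M[R]_(1, 2)) i j = 0 by rewrite mxE.
exact: etrans (block_mxEdl G 0 0 0 i j) z.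
Qed.

Lemma embed3_dr G (i j : 'I_1) :
  embed3 G (rshift 2 i : 'I_(2 + 1)) (rshift 2 j : 'I_(2 + 1)) = 0.
Proof.
have z : (0 : 'M[R]_(1, 1)) i j = 0 by rewrite mxE.
exact: etrans (block_mxEdr G 0 0 0 i j) z.
Qed.

Lemma frob_embed3 G : frob (embed3 G) (embed3 G) = frob G G.
Proof.
rewrite /frob (@big_split_ord _ _ _ 2 1) /= [X in _ + X]big1 ?addr0.
  apply: eq_bigr => i _; rewrite (@big_split_ord _ _ _ 2 1) /= [X in _ + X]big1 ?addr0.
    by apply: eq_bigr => j _; rewrite embed3_ul.
  by move=> j _; rewrite embed3_ur mul0r.
move=> i _; rewrite (@big_split_ord _ _ _ 2 1) /= !big1 ?addr0// => j _.
  by rewrite embed3_dr mul0r.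
by rewrite embed3_dl mul0r.
Qed.

Lemma embed3_sym G : is_symmx G -> is_symmx (embed3 G).
Proof.
move=> sG; have E : (block_mx G 0 0 0 : 'M[R]_(2 + 1))^T = block_mx G 0 0 0.
  by rewrite tr_block_mx sG !trmx0.
exact: E.
Qed.

Lemma bending_sym G x : is_symmx G -> is_symmx (bending G x).
Proof.
by move=> sG; apply: embed3_sym; apply/matrixP => i j; rewrite !mxE -[in LHS]sG mxE.
Qed.

Lemma rel_strain_sym M D x : is_symmx M -> is_symmx (rel_strain gamma M D x).
Proof.
move=> sM; rewrite /rel_strain -[embed3 M]scale1r; apply: symmx_comb.
  exact: embed3_sym.
exact: sympart_is_sym.
Qed.

Lemma frob_bending G x : frob (bending G x) (bending G x) = frob G G * x.1 ^+ 2.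
Proof.
rewrite -frob_embed3 /frob mulr_suml; apply: eq_bigr => i _.
by rewrite mulr_suml; apply: eq_bigr => j _; rewrite bending_entry; ring.
Qed.

Lemma integrable_x3sqr : mu.-integrable (box Lam) (EFin \o (fun x => x.1 ^+ 2)).
Proof. exact: L2on_sqr mB (L2on_x3 uL). Qed.

Lemma integral_frob_bending G : is_symmx G ->
  \int[mu]_(x in box Lam) frob (sympart (bending G x)) (sympart (bending G x)) =
  frob G G * (vol / 12).
Proof.
move=> sG; rewrite -integral_box_x3sqr -(RintegralZl _ mB integrable_x3sqr).
by apply: eq_Rintegral => x _; rewrite sympart_sym ?frob_bending//; exact: bending_sym.
Qed.

(** On expanding the square, the cross term integrates to zero and [N x ^+ 2] is dropped. *)
Lemma integral_sqr_affine (g : R) (N : mpt R -> R) :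
  L2on mu (box Lam : set (mpt R)) N -> \int[mu]_(x in box Lam) (x.1 * N x) = 0 ->
  g ^+ 2 * (vol / 12) <= \int[mu]_(x in box Lam) ((g * x.1 + N x) ^+ 2).
Proof.
move=> lN N0.
have lA : L2on mu (box Lam : set (mpt R)) (fun x => g * x.1 + N x).
  by apply: L2onD => //; apply: L2onZ => //; exact: L2on_x3.
have iN := L2on_mul mB (L2on_x3 uL) lN.
have i2 := integrableZ_EFin (2 * g) mB iN.
apply: (@le_trans _ _ (\int[mu]_(x in box Lam)
    (g ^+ 2 * x.1 ^+ 2 + 2 * g * (x.1 * N x)))).
  rewrite (Rintegral_comb _ mB integrable_x3sqr i2) (RintegralZl _ mB iN) N0.
  by rewrite mulr0 addr0 integral_box_x3sqr.
apply: le_Rintegral => //.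
- exact: integrableD_EFin mB (integrableZ_EFin _ mB integrable_x3sqr) i2.
- exact: L2on_sqr.
by move=> x _; have := sqr_ge0 (N x); rewrite !expr2; nra.
Qed.

(** The upper-left block sees only derivatives along y, so [gamma] disappears from it. *)
Lemma block_entry G M (D : pt3 R -> 'M[R]_3) x (i j : 'I_2) : is_symmx G ->
  is_symmx M ->
  (bending G x + rel_strain gamma M D x) (lshift 1 i) (lshift 1 j) =
  G i j * x.1 + (M i j + 2^-1 * (D x (lshift 1 i) (lshift 1 j) +
    D x (lshift 1 j) (lshift 1 i))).
Proof.
move=> sG sM; rewrite mxE bending_entry [X in _ + X]mxE embed3_ul embed3_ul.
have l2 (k : 'I_2) : (lshift 1 k == 2%N :> nat) = false.
  by rewrite /= ltn_eqF.
rewrite mulrC; congr (_ + (_ + _)).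
by rewrite !mxE !l2 !mul1r.
Qed.

(* The upper-left block of the strain is [x_3 G + N] where [x_3 N] has zero
   integral over the box; the other entries are dropped. *)
Lemma integral_frob_lower G (chi : pt3 R -> 'M[R]_3) : is_symmx G ->
  Hrel gamma Lam chi ->
  frob G G * (vol / 12) <=
  \int[mu]_(x in box Lam) frob (sympart (bending G x + chi x))
    (sympart (bending G x + chi x)).
Proof.
move=> sG [M [phi [D [sM h cE]]]].
have [hl pp lp lD] := (H1gammaP gamma_gt0 uL phi D).1 h.
pose F x := bending G x + rel_strain gamma M D x.
have lF : L2 F.
  have := L2field_comb mB 1 (L2_bending uL G) (L2_rel_strain gamma_gt0 uL M h).
  by apply: L2field_ext => x _; rewrite fctE scale1r.
have sF x : is_symmx (F x).
  rewrite /F -[bending G x]scale1r; apply: symmx_comb; first exact: bending_sym.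
  exact: rel_strain_sym.
have lij (i j : 'I_2) := lF (lshift 1 i) (lshift 1 j).
rewrite (_ : \int[mu]_(x in box Lam) _ = \int[mu]_(x in box Lam) frob (F x) (F x));
  last first.
  apply: eq_Rintegral => x /set_mem bx; rewrite (cE x (box_layer bx)).
  by rewrite -/(F x) (sympart_sym (sF x)).
pose S x := \sum_(i : 'I_2) \sum_(j : 'I_2) F x (lshift 1 i) (lshift 1 j) ^+ 2.
have i1 (i j : 'I_2) := L2on_sqr mB (lij i j).
have i2 (i : 'I_2) : mu.-integrable (box Lam)
    (EFin \o (fun x => \sum_(j : 'I_2) F x (lshift 1 i) (lshift 1 j) ^+ 2)).
  rewrite (_ : EFin \o _ = (fun x : mpt R => \sum_(j : 'I_2)
      (F x (lshift 1 i) (lshift 1 j) ^+ 2)%:E)%E).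
    by apply: integrable_sum => // j _; exact: i1.
  by apply/funext => x; rewrite /= sumEFin.
have iS : mu.-integrable (box Lam) (EFin \o S).
  rewrite (_ : EFin \o _ = (fun x : mpt R => \sum_(i : 'I_2)
      (\sum_(j : 'I_2) F x (lshift 1 i) (lshift 1 j) ^+ 2)%:E)%E).
    by apply: integrable_sum => // i _; exact: i2.
  by apply/funext => x; rewrite /= sumEFin.
apply: (@le_trans _ _ (\int[mu]_(x in box Lam) S x)); last first.
  apply: le_Rintegral => //; first exact: integrable_frob.
  move=> x _; apply: le_trans (frob_block (F x)).
  rewrite /S /frob; apply: ler_sum => i _; apply: ler_sum => j _.
  by rewrite !mxE expr2.
rewrite (Rintegral_sum mB i2) /frob mulr_suml; apply: ler_sum => i _.
rewrite (Rintegral_sum mB (i1 i)) mulr_suml; apply: ler_sum => j _.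
pose N (x : mpt R) := M i j + 2^-1 * (D x (lshift 1 i) (lshift 1 j) +
    D x (lshift 1 j) (lshift 1 i)).
have l1 := lD (lshift 1 i) (lshift 1 j).
have l2 := lD (lshift 1 j) (lshift 1 i).
have lN : L2on mu (box Lam : set (mpt R)) N.
  by apply: L2onD => //; [exact: L2on_cst|apply: L2onZ => //; exact: L2onD].
rewrite (_ : \int[mu]_(x in box Lam) _ =
    \int[mu]_(x in box Lam) ((G i j * x.1 + N x) ^+ 2)); last first.
  by apply: eq_Rintegral => x _; rewrite /F block_entry.
rewrite -expr2; apply: integral_sqr_affine => //.
(* The column [l] is one of the first two, so [D] is differentiated along y, as
   [integral_box_gradient] demands. *)
have z (k l : 'I_2) : \int[mu]_(x in box Lam)
    (x.1 * D x (lshift 1 k) (lshift 1 l)) = 0.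
  apply: (@integral_box_gradient R Lam phi D (lshift 1 k) (lshift 1 l) uL hl pp).
    by rewrite /= ltn_eqF.
  exact: L2on_int mB (box_fin uL) (lD _ _).
have m1 := L2on_mul mB (L2on_x3 uL) l1.
have m2 := L2on_mul mB (L2on_x3 uL) l2.
have m0 := L2on_int mB (box_fin uL) (L2on_x3 uL).
have m2' := integrableZ_EFin 2^-1 mB m2.
have m3 := integrableD_EFin mB (integrableZ_EFin 2^-1 mB m1) m2'.
transitivity (M i j * \int[mu]_(x in box Lam) x.1 +
  (2^-1 * \int[mu]_(x in box Lam) (x.1 * D x (lshift 1 i) (lshift 1 j)) +
   2^-1 * \int[mu]_(x in box Lam) (x.1 * D x (lshift 1 j) (lshift 1 i)))).
  rewrite -[X in _ = _ + (_ + X)](RintegralZl _ mB m2).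
  rewrite -(Rintegral_comb _ mB m1 m2') -(Rintegral_comb _ mB m0 m3).
  by apply: eq_Rintegral => x _; rewrite /N; ring.
by rewrite integral_box_x3 !z !mulr0 !addr0.
Qed.

End BendingBounds.

(** Turns periodicity of the prestrain, given for almost every x_3, into periodicity at almost every
    point, as [HL] asks. *)
Lemma ae_product_fst (R : realType) d1 d2 (T1 : measurableType d1)
    (T2 : measurableType d2) (m1 : {sigma_finite_measure set T1 -> \bar R})
    (m2 : {sigma_finite_measure set T2 -> \bar R}) (P : T1 -> Prop) :
  {ae m1, forall x, P x} -> {ae (m1 \x m2)%E, forall z, P z.1}.
Proof.
move=> [N [mN N0 PN]]; exists (N `*` setT); split.
- exact: measurableX.
- have /= -> := product_measure1E m1 m2 mN measurableT.
  by rewrite (_ : m1 N = 0%E)// mul0e.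
- by move=> [x y] /= nP; split => //; exact: PN.
Qed.

(** * The energy inner product on the box *)

Section InnerProduct.
Context {R : realType}.
Variables (alpha beta gamma : R) (Lam : 'M[R]_2) (Q : pt3 R -> 'M[R]_3 -> R).
Hypotheses (alpha_gt0 : 0 < alpha) (gamma_gt0 : 0 < gamma) (uL : Lam \in unitmx).
Hypothesis admQ : admissible_form alpha beta Lam Q.
Implicit Types (G M : 'M[R]_2) (B F U W : pt3 R -> 'M[R]_3).

Local Notation mu := (@leb3 R).
Local Notation vol := (fine (@leb3 R (box Lam))).
Local Notation L2 := (L2field mu (box Lam : set (mpt R))).
Local Notation ip := (ipL Lam Q).

Let mB : measurable (box Lam : set (mpt R)) := measurable_box uL.

Let measurable_Q (F : mpt R -> 'M[R]_3) :
  (forall i j, measurable_fun (box Lam : set (mpt R)) (fun x => F x i j)) ->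
  measurable_fun (box Lam : set (mpt R)) (fun x => Q x (F x)).
Proof.
move=> mF; have [bQ _ _] := admQ.
exact: (measurable_form bQ mB (@box_layer _ Lam) mF).
Qed.

Let quad_Q : {ae mu, forall x, (box Lam : set (mpt R)) x -> quad_class alpha beta (Q x)}.
Proof.
have [_ qQ _] := admQ.
by apply: (@ae_imp _ _ _ mu _ _ qQ) => x H bx; apply: H; exact: box_layer bx.
Qed.

Let en := energy mu (box Lam : set (mpt R)) Q.

Lemma ipLE F U : ip F U = vol^-1 * en F U.
Proof. by []. Qed.

Let volV_gt0 : 0 < vol^-1.
Proof. by rewrite invr_gt0 vol_gt0. Qed.

Lemma ipLC F U : ip F U = ip U F.
Proof. by rewrite !ipLE /en energyC. Qed.

Lemma ipL_ext F U W Z : (forall x, box Lam x -> F x = W x) ->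
  (forall x, box Lam x -> U x = Z x) -> ip F U = ip W Z.
Proof.
by move=> FW UZ; rewrite !ipLE /en (energy_ext mu Q FW UZ).
Qed.

Lemma ipL_comb (c : R) F U W : L2 F -> L2 U -> L2 W ->
  ip (c *: F + U) W = c * ip F W + ip U W.
Proof.
move=> lF lU lW; rewrite !ipLE /en.
rewrite (energy_comb mB (ltW alpha_gt0) measurable_Q quad_Q c lF lU lW).
by rewrite mulrDr mulrCA.
Qed.

Lemma ipL_ge0 F : L2 F -> 0 <= ip F F.
Proof.
move=> lF; rewrite ipLE mulr_ge0 ?(ltW volV_gt0)//.
exact: (energy_ge0 mB (ltW alpha_gt0) measurable_Q quad_Q lF).
Qed.

Lemma ipL_diag F : L2 F -> ip F F = avg Lam (fun x => Q x (F x)).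
Proof.
move=> lF; rewrite ipLE /avg; congr (_ * _).
exact: (energy_diag mB (ltW alpha_gt0) measurable_Q quad_Q lF).
Qed.

Lemma ipL_bending_upper G : is_symmx G ->
  ip (bending G) (bending G) <= beta / 12 * frob G G.
Proof.
move=> sG; have lb := L2_bending uL G.
have := energy_upper mB (ltW alpha_gt0) measurable_Q quad_Q lb.
rewrite (integral_frob_bending uL sG) ipLE => H.
rewrite mulrC ler_pdivrMr ?vol_gt0//; apply: le_trans H _.
by rewrite le_eqVlt; apply/orP; left; apply/eqP; ring.
Qed.

Lemma ipL_lower G chi : is_symmx G -> Hrel gamma Lam chi ->
  alpha / 12 * frob G G <= ip (bending G + chi) (bending G + chi).
Proof.
move=> sG hc; have lb := L2_bending uL G.
have lc := L2_Hrel gamma_gt0 uL hc.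
have lF : L2 (bending G + chi) by rewrite -[bending G]scale1r; exact: L2field_comb.
have := energy_lower mB (ltW alpha_gt0) measurable_Q quad_Q lF.
have := integral_frob_lower gamma_gt0 uL sG hc.
rewrite -(ler_pM2l alpha_gt0) => h1 h2.
rewrite ipLE [leRHS]mulrC ler_pdivlMr ?vol_gt0//; apply: le_trans h2.
apply: le_trans h1.
by rewrite le_eqVlt; apply/orP; left; apply/eqP; ring.
Qed.

Lemma HL_bending G : is_symmx G -> HL Lam (bending G).
Proof.
move=> sG; split.
- move=> i j; apply: (eq_measurable_fun (fun x : mpt R => embed3 G i j * x.1)).
    by move=> x _; rewrite bending_entry mulrC.
  by apply: measurable_funM; [exact: measurable_cst|exact: measurable_x3].
- by apply: aeW => x _; exact: bending_sym.
- by move=> k; apply: aeW => x _.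
have /integrableP[_] := integrable_frob_box uL (L2_bending uL G).
rewrite (eq_integral (fun x : mpt R => (frob (bending G x) (bending G x))%:E))// => x _.
by rewrite /= ger0_norm ?frob_ge0.
Qed.

Lemma prestrain_L2 B : admissible_prestrain Lam B -> L2 B.
Proof.
move=> [bB _ fB _]; apply: frob_finite_L2on fB => // i j.
by apply: measurable_box_layer; exact: measurable_prestrain.
Qed.

Lemma HL_prestrain B : admissible_prestrain Lam B ->
  HL Lam (fun x => sympart (B x)).
Proof.
move=> aB; have [bB sB _ pB] := aB; split.
- move=> i j; apply: (eq_measurable_fun (fun x : mpt R => 2^-1 * (B x i j + B x j i))).
    by move=> x _; rewrite !mxE.
  apply: measurable_funM; first exact: measurable_cst.
  by apply: measurable_funD; exact: measurable_prestrain.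
- by apply: aeW => x _; exact: sympart_is_sym.
- move=> k; have := ae_product_fst (@leb2 R) pB.
  move=> H; apply: (@ae_imp _ _ _ mu _ _ H) => -[x3 y] /= Hx lx.
  by rewrite Hx.
have /integrableP[_] := integrable_frob_box uL (L2field_sympart mB (prestrain_L2 aB)).
rewrite (eq_integral (fun x : mpt R =>
  (frob (sympart (B x)) (sympart (B x)))%:E))// => x _.
by rewrite /= ger0_norm ?frob_ge0.
Qed.

End InnerProduct.

(** * Coordinates with respect to the orthonormal basis *)

Section Coordinates.
Context {R : realType}.

Lemma quad_valE n (A : 'M[R]_n) (v : 'cV[R]_n) :
  quad_val A v = \sum_i \sum_j A i j * v i 0 * v j 0.
Proof.
rewrite /quad_val mxE exchange_big; apply: eq_bigr => j _.
rewrite mxE mulr_suml; apply: eq_bigr => i _.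
by rewrite mxE; ring.
Qed.

Lemma bending_sum (c : 'I_3 -> R) (Gs : 'I_3 -> 'M[R]_2) :
  bending (\sum_i c i *: Gs i) = \sum_i c i *: bending (Gs i).
Proof.
have bC (k : R) (G M : 'M[R]_2) : bending (k *: G + M) = k *: bending G + bending M.
  apply/funext => x; rewrite /bending scalerDr.
  rewrite -[LHS]/(embed3 (x.1 *: (k *: G) + x.1 *: M)).
  by rewrite scalerA mulrC -scalerA embed3_comb.
elim/big_rec2: _ => [|i y u _ <-]; last by rewrite bC.
have := bC (-1) 0 0; rewrite scaler0 addr0 => E.
by rewrite {1}E scaleN1r addNr.
Qed.

Lemma symmx_sum (c : 'I_3 -> R) (Gs : 'I_3 -> 'M[R]_2) :
  (forall i, is_symmx (Gs i)) -> is_symmx (\sum_i c i *: Gs i).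
Proof.
move=> sG; elim/big_rec: _ => [|i u _ su]; first exact: trmx0.
exact: symmx_comb.
Qed.

Lemma frob_orthonormal (c : 'cV[R]_3) (Gs : 'I_3 -> 'M[R]_2) :
  (forall i j, frob (Gs i) (Gs j) = (i == j)%:R) ->
  frob (\sum_i c i 0 *: Gs i) (\sum_i c i 0 *: Gs i) = frob c c.
Proof.
move=> oG.
have fl (F G M : 'M[R]_2) k : frob (k *: F + G) M = k * frob F M + frob G M.
  rewrite /frob mulr_sumr -big_split; apply: eq_bigr => i _ /=.
  by rewrite mulr_sumr -big_split; apply: eq_bigr => j _ /=; rewrite !mxE; ring.
have fC (F M : 'M[R]_2) : frob F M = frob M F.
  by rewrite /frob; apply: eq_bigr => i _; apply: eq_bigr => j _; rewrite mulrC.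
have fs (M : 'M[R]_2) : frob (\sum_i c i 0 *: Gs i) M = \sum_i c i 0 * frob (Gs i) M.
  elim/big_rec2: _ => [|i y u _ <-]; last by rewrite fl.
  by have := fl 0 0 M (-1); rewrite scaler0 addr0 mulN1r addNr.
rewrite fs [RHS]/frob; apply: eq_bigr => i _.
rewrite big_ord1 fC fs (bigD1 i)//= oG eqxx mulr1 big1 ?addr0// => j ji.
by rewrite oG (negbTE ji) mulr0.
Qed.

End Coordinates.

Theorem proposition2p25 (R : realType) (alpha beta gamma C : R)
    (Lam : 'M[R]_2)
    (Q : pt3 R -> 'M[R]_3 -> R) (B : pt3 R -> 'M[R]_3)
    (Gs Ms : 'I_3 -> 'M[R]_2)
    (phis : 'I_3 -> pt3 R -> 'cV[R]_3) (Ds : 'I_3 -> pt3 R -> 'M[R]_3) :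
  0 < alpha -> alpha <= beta -> 0 < gamma -> 0 < C ->
  Lam \in unitmx ->
  (forall v : 'cV[R]_2,
     C^-1 * frob v v <= quad_val (Lam^T *m Lam) v <= C * frob v v) ->
  admissible_form alpha beta Lam Q ->
  admissible_prestrain Lam B ->
  orthonormal_sym_basis Gs ->
  (forall i, is_corrector gamma Lam Q (Gs i) (Ms i) (phis i) (Ds i)) ->
  [/\ is_symmx (Qhat gamma Lam Q Gs Ms Ds),
      forall xi : 'cV[R]_3, xi != 0 ->
        0 < quad_val (Qhat gamma Lam Q Gs Ms Ds) xi,
      forall xi : 'cV[R]_3,
        alpha / 12 * frob xi xi <= quad_val (Qhat gamma Lam Q Gs Ms Ds) xi
          <= beta / 12 * frob xi xi,
      forall (G : 'M[R]_2) (Ghat : 'cV[R]_3), is_symmx G ->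
        G = \sum_i Ghat i 0 *: Gs i ->
        Qhom gamma Lam Q G =
        \sum_i \sum_j Qhat gamma Lam Q Gs Ms Ds i j * Ghat i 0 * Ghat j 0
    & forall G : 'M[R]_2,
        is_Beff gamma Lam Q B G <->
        G = \sum_i (invmx (Qhat gamma Lam Q Gs Ms Ds) *m
                    Bhat gamma Lam Q B Gs Ms Ds) i 0 *: Gs i].
Proof.
move=> alpha_gt0 _ gamma_gt0 _ uL _ admQ admB [sGs oGs spanGs] corr.
set mu := @leb3 R; set A := Qhat gamma Lam Q Gs Ms Ds.
pose L := L2field (@leb3 R) (box Lam : set (mpt R)).
pose H := Hrel gamma Lam.
pose a := ipL Lam Q.
pose b i := bending (Gs i) : pt3 R -> 'M[R]_3.
pose E i := (fun x => bending (Gs i) x + rel_strain gamma (Ms i) (Ds i) x)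
  : pt3 R -> 'M[R]_3.
have L_comb : comb_closed L.
  by move=> k u v; exact: (L2field_comb (measurable_box uL)).
have H_comb : comb_closed H by exact: Hrel_comb.
have H_sub u : H u -> L u by exact: L2_Hrel.
have aC u v : a u v = a v u by exact: ipLC.
have a_comb (k : R) u v w : L u -> L v -> L w -> a (k *: u + v) w = k * a u w + a v w.
  exact: (ipL_comb alpha_gt0 uL admQ).
have a_ge0 u : L u -> 0 <= a u u by exact: (ipL_ge0 alpha_gt0 uL admQ).
have b_L i : L (b i) by exact: L2_bending.
have E_sub_b i : H (E i - b i).
  have [sM h _ _] := corr i; exists (Ms i), (phis i), (Ds i); split => // x _.
  by rewrite /E /b -[LHS]/(bending (Gs i) x + rel_strain gamma (Ms i) (Ds i) x
    - bending (Gs i) x) addrC addKr.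
have E_orth i h : H h -> a (E i) h = 0.
  move=> [M [phi [D [sM hD hE]]]]; have [_ _ _ orth] := corr i.
  rewrite /a (@ipL_ext _ _ _ _ _ (E i) (rel_strain gamma M D))//; last first.
    by move=> x bx; rewrite hE//; exact: box_layer bx.
  by rewrite /ipL /avg (orth M phi D sM hD) mulr0.
have AE i k : A i k = a (E i) (b k) by rewrite mxE.
have comb_form (xi : 'cV[R]_3) : \sum_i \sum_j A i j * xi i 0 * xi j 0 =
    a (\sum_i xi i 0 *: E i) (\sum_i xi i 0 *: E i).
  rewrite (a_E_comb L_comb H_sub aC a_comb b_L E_sub_b E_orth (fun i => xi i 0)).
  by apply: eq_bigr => i _; apply: eq_bigr => j _; rewrite AE.
have symA i k : A i k = A k i.
  by rewrite !AE (a_E_sym L_comb H_sub aC a_comb b_L E_sub_b E_orth).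
(* A combination of the [E i] is a bending strain plus a relaxation strain. This splitting gives the
   lower bound, attainment of the infimum and membership in [Hrel_perp]. *)
have decomp c : \sum_i c i *: E i =
    bending (\sum_i c i *: Gs i) + (\sum_i c i *: E i - \sum_i c i *: b i).
  by rewrite bending_sum addrC subrK.
have Hsub c := E_comb_sub H_comb E_sub_b c.
have bounds (xi : 'cV[R]_3) :
    alpha / 12 * frob xi xi <= quad_val A xi <= beta / 12 * frob xi xi.
  rewrite quad_valE comb_form -(frob_orthonormal xi oGs).
  have sG := symmx_sum (fun i => xi i 0) sGs.
  apply/andP; split.
    rewrite [X in a X X]decomp.
    exact: (ipL_lower alpha_gt0 gamma_gt0 uL admQ sG (Hsub _)).
  apply: le_trans (ipL_bending_upper alpha_gt0 uL admQ sG).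
  have H0 : H 0 := comb_closed0 H_comb (E_sub_b 0).
  have := E_comb_min L_comb H_comb H_sub aC a_comb a_ge0 b_L E_sub_b E_orth
    (fun i => xi i 0) H0.
  by rewrite addr0 bending_sum.
have posA (xi : 'cV[R]_3) : xi != 0 -> 0 < quad_val A xi.
  move=> xi0; have /andP[+ _] := bounds xi; apply: lt_le_trans.
  rewrite mulr_gt0 ?divr_gt0// lt_neqAle frob_ge0 andbT eq_sym.
  apply: contraNneq xi0 => f0; apply/eqP/matrixP => i j.
  have := frob_entry xi i j; rewrite f0 mxE => h.
  by apply/eqP; rewrite -sqrf_eq0 eq_le h sqr_ge0.
have symmA : is_symmx A by apply/matrixP => i j; rewrite mxE symA.
(* A nonzero vector in the kernel would have quadratic value 0, against [posA]. *)
have uA : A \in unitmx.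
  rewrite unitmxE unitfE; apply/det0P => -[v v0 vA].
  have v0' : v^T != 0 by rewrite -trmx0 (inj_eq (@trmx_inj _ _ _)).
  by have := posA _ v0'; rewrite /quad_val trmxK vA mul0mx mxE ltxx.
split => //.
- move=> G g sG GE; rewrite comb_form.
  set r0 := a _ _.
  have lE : L (\sum_i g i 0 *: E i).
    exact: (L_E_comb L_comb H_sub b_L E_sub_b).
  rewrite /Qhom; set S := [set r | _].
  (* The infimum is attained: the relaxation part of the combination of the [E i] is an admissible
     competitor for [G]. *)
  have Sr0 : S r0.
    have [M [phi [D [sM hD hE]]]] := Hsub (fun i => g i 0).
    exists M, phi, D; split => //.
    rewrite /r0 /a (ipL_diag alpha_gt0 uL admQ lE); congr (_ * _).
    apply: eq_Rintegral => x /set_mem bx; congr (Q x _).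
    rewrite GE -hE; last exact: box_layer bx.
    by rewrite {1}decomp.
  have lb r : S r -> r0 <= r.
    move=> [M [phi [D [sM hD ->]]]].
    pose h := rel_strain gamma M D.
    have Hh : H h by exists M, phi, D.
    have := E_comb_min L_comb H_comb H_sub aC a_comb a_ge0 b_L E_sub_b E_orth
      (fun i => g i 0) Hh.
    have lF : L (\sum_i g i 0 *: b i + h).
      apply: (comb_closedD L_comb); last exact: H_sub.
      exact: (comb_closed_sum _ L_comb b_L).
    rewrite -/r0 [X in _ <= X](ipL_diag alpha_gt0 uL admQ lF).
    by rewrite -bending_sum -GE.
  (* [S] is nonempty and bounded below by its own element [r0], so [inf] is a true infimum and not a
     default value. *)
  apply/eqP; rewrite eq_le; apply/andP; split.
    by apply: ge_inf => //; exists r0.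
  by apply: lb_le_inf; [exists r0|].
have lB : L B by exact: prestrain_L2 admB.
have BhE j : Bhat gamma Lam Q B Gs Ms Ds j 0 = a B (E j) by rewrite mxE aC.
set Bh := Bhat gamma Lam Q B Gs Ms Ds in BhE *.
(* By symmetry of [A] the left sides are the entries of [A *m c]. *)
have system (c : 'cV[R]_3) : (forall j, \sum_i c i 0 * a (E i) (b j) = a B (E j)) <->
    c = invmx A *m Bh.
  split.
    move=> h; rewrite -[LHS](mulKmx uA); congr (_ *m _).
    apply/matrixP => j k; rewrite ord1 BhE -h mxE; apply: eq_bigr => i _.
    by rewrite symA AE mulrC.
  move=> -> j; rewrite -BhE -[in RHS](mulKVmx uA Bh) [RHS]mxE; apply: eq_bigr => i _.
  by rewrite -AE symA mulrC.
have symB x : box Lam x -> sympart (B x) = B x.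
  by move=> bx; apply: sympart_sym; have [_ + _ _] := admB; apply; exact: box_layer bx.
have E_perp j : Hrel_perp gamma Lam Q (E j).
  split; last by move=> chi; exact: E_orth.
  have [sM hD _ _] := corr j.
  exists (Gs j), (rel_strain gamma (Ms j) (Ds j)); split => //.
  by exists (Ms j), (phis j), (Ds j).
have Hgamma_L V : Hgamma gamma Lam V -> L V.
  move=> [G [chi [_ Hc VE]]].
  have lb : L (bending G) by exact: L2_bending.
  apply: L2field_ext (comb_closedD L_comb lb (H_sub _ Hc)) => x bx.
  by rewrite VE//; exact: box_layer bx.
move=> G; split.
- move=> [sG [V [[_ [HV _] oV] [_ _ oV']]]].
  have [c GE] := spanGs G sG.
  have lV := Hgamma_L V HV.
  suff -> : invmx A *m Bh = c by [].
  (* Both projections are represented by the same [V], so testing each against [E j] gives the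
     normal equations for [c]. *)
  apply/esym/system => j.
  apply: (proj_E_coef L_comb H_sub aC a_comb b_L E_sub_b E_orth lB lV).
    by have := oV (E j) (E_perp j); rewrite GE bending_sum.
  have := oV' (E j) (E_perp j).
  by rewrite (@ipL_ext _ _ _ _ _ (B - V) (E j))// => x bx; rewrite symB.
- set c := invmx A *m Bh => GE.
  have hc := (system c).2 erefl.
  have sG : is_symmx G by rewrite GE; exact: symmx_sum.
  (* With coefficients solving the normal equations, this combination represents both projections at
     once. *)
  split => //; exists (\sum_i c i 0 *: E i).
  have pV : Hrel_perp gamma Lam Q (\sum_i c i 0 *: E i).
    split.
      exists G, (\sum_i c i 0 *: E i - \sum_i c i 0 *: b i); split => //.
        exact: (Hsub (fun i => c i 0)).
      by move=> x _; rewrite {1}decomp GE.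
    move=> chi Hc.
    exact: (E_comb_orth L_comb H_sub a_comb b_L E_sub_b E_orth).
  have key F : Hrel_perp gamma Lam Q F ->
      a (\sum_i c i 0 *: b i - \sum_i c i 0 *: E i) F = 0 /\
      a (B - \sum_i c i 0 *: E i) F = 0.
    move=> [[G' [h [sG' Hh FE]]] Fo].
    have [d dE] := spanGs G' sG'.
    (* The decomposition of [F] holds only on the layer, whereas the abstract lemma wants an
       equality of functions. [F'] satisfies it everywhere and has the same inner products. *)
    pose F' := \sum_i d i 0 *: b i + h.
    have FF' x : box Lam x -> F x = F' x.
      move=> bx; rewrite FE; last exact: box_layer bx.
      by rewrite /F' -bending_sum -dE.
    have ext W : a W F = a W F' by exact: ipL_ext.
    rewrite !ext.
    apply: (E_comb_is_proj L_comb H_comb H_sub aC a_comb a_ge0 b_L E_sub_b E_orth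
      lB hc (F := F') (d := fun i => d i 0) (h := h)) => //.
    move=> k Hk; rewrite aC (_ : a k F' = a k F); last exact/esym/ext.
    by rewrite aC; exact: Fo.
  split; split => //.
  + exact: HL_bending.
  + move=> F pF; have [+ _] := key F pF.
    by rewrite -bending_sum -GE.
  + exact: (HL_prestrain uL admB).
  + move=> F pF; have [_ <-] := key F pF.
    by apply: ipL_ext => // x bx; rewrite symB.
Qed.
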